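(* A topological space $Y$ is homeomorphic to the edge-end space $\Omega_E(G)$ of some connected graph $G$ if and only if there is a graph-theoretic tree $T$ and a subspace $X\subseteq \|T\|$ with $\Omega_E(T)\subseteq X$ such that $Y$ is homeomorphic to $X$.
   Context: Graphs may be infinite. A ray is a one-way infinite path. Two rays of a graph $G=(V,E)$ are edge-equivalent if no finite set of edges separates them; the equivalence classes are the edge-ends, forming $\Omega_E(G)$. A region of $G$ is a connected induced subgraph $C$ with finite boundary $\partial C=\{xy\in E: x\in C, y\notin C\}$. For a region $C$, $\Omega_E(C)$ is the set of edge-ends having a ray contained in $C$, and $\|C\|=V(C)\cup\Omega_E(C)$. The edge-end space $\Omega_E(G)$ has as basis the sets $\Omega_E(C)$ for regions $C$; the space $\|G\|=V(G)\cup\Omega_E(G)$ has as basis the sets $\|C\|$ for regions $C$ of $G$. For a tree $T$, $\|T\|$ is a compact Hausdorff space. *)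

(* Defs.v *)
From HB Require Import structures.
From mathcomp Require Import all_boot all_order all_algebra.
From mathcomp Require Import all_classical all_reals all_analysis.

Set Implicit Arguments.
Unset Strict Implicit.
Unset Printing Implicit Defensive.

Local Open Scope classical_set_scope.

Record graph := Graph {
  vtx : Type;
  adj : vtx -> vtx -> Prop;
  adj_sym : forall x y, adj x y -> adj y x;
  adj_irrefl : forall x, ~ adj x x }.

Definition joined {V : Type} (e : V -> V -> Prop) (x y : V) : Prop :=
  exists (n : nat) (p : nat -> V),
    [/\ p 0%N = x, p n = y & forall i, (i < n)%N -> e (p i) (p i.+1)].

Definition connected_graph (G : graph) : Prop :=
  inhabited (vtx G) /\ forall x y : vtx G, joined (@adj G) x y.

Definition has_cycle (G : graph) : Prop :=
  exists (n : nat) (f : nat -> vtx G),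
    [/\ (3 <= n)%N,
        (forall i j, (i < n)%N -> (j < n)%N -> f i = f j -> i = j),
        (forall i, (i.+1 < n)%N -> adj (f i) (f i.+1)) &
        adj (f n.-1) (f 0%N)].

Definition is_tree (G : graph) : Prop := connected_graph G /\ ~ has_cycle G.

Definition is_ray (G : graph) (r : nat -> vtx G) : Prop :=
  injective r /\ forall n, adj (r n) (r n.+1).

Definition ray (G : graph) := {r : nat -> vtx G | is_ray r}.

(* A set of edges is given by a set F of ordered pairs; the (undirected)
   edge xy belongs to it iff (x,y) \in F or (y,x) \in F. *)
Definition adj_minus (G : graph) (F : set (vtx G * vtx G)) (x y : vtx G) :=
  adj x y /\ ~ F (x, y) /\ ~ F (y, x).

Definition edge_equiv (G : graph) (r1 r2 : ray G) : Prop :=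
  forall F : set (vtx G * vtx G), finite_set F ->
    exists n m : nat, forall i j, (n <= i)%N -> (m <= j)%N ->
      joined (adj_minus F) (sval r1 i) (sval r2 j).

Definition edge_end (G : graph) :=
  {A : set (ray G) | exists r : ray G, A = [set r' | edge_equiv r r']}.

Definition boundary (G : graph) (C : set (vtx G)) : set (vtx G * vtx G) :=
  [set xy | [/\ C xy.1, ~ C xy.2 & adj xy.1 xy.2]].

Definition is_region (G : graph) (C : set (vtx G)) : Prop :=
  [/\ C !=set0,
      (forall x y, C x -> C y -> joined (fun u v => [/\ C u, C v & adj u v]) x y) &
      finite_set (boundary C)].

Definition OmegaE (G : graph) (C : set (vtx G)) : set (edge_end G) :=
  [set w | exists r : ray G, sval w r /\ forall n, C (sval r n)].

Definition vend (G : graph) := (vtx G + edge_end G)%type.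

Definition vendC (G : graph) (C : set (vtx G)) : set (vend G) :=
  [set z | match z with inl v => C v | inr w => OmegaE C w end].

HB.instance Definition _ (G : graph) := gen_eqMixin (edge_end G).
HB.instance Definition _ (G : graph) := gen_choiceMixin (edge_end G).
HB.instance Definition _ (G : graph) := gen_eqMixin (vend G).
HB.instance Definition _ (G : graph) := gen_choiceMixin (vend G).

HB.instance Definition _ (G : graph) :=
  @isSubBaseTopological.Build (edge_end G) (set (vtx G))
    (@is_region G) (@OmegaE G).

HB.instance Definition _ (G : graph) :=
  @isSubBaseTopological.Build (vend G) (set (vtx G))
    (@is_region G) (@vendC G).

Definition ends_in (G : graph) : set (vend G) := range (@inr (vtx G) (edge_end G)).

Definition homeomorphic (X Y : topologicalType) : Prop :=
  exists (f : X -> Y) (g : Y -> X),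
    [/\ cancel f g, cancel g f, continuous f & continuous g].

(* Main.v *)
Require Import Defs.
From HB Require Import structures.
From mathcomp Require Import all_boot all_order all_algebra.
From mathcomp Require Import finmap zify.
From mathcomp Require Import all_classical all_reals all_analysis.

(* Let T be a tree and f : V(G) -> V(T) a surjection that is a uniform equivalence
   for separation by finite edge sets: every finite set of edges of T is refined by
   one of G, and vice versa. Then sending an end of G to the limit in |T| of the
   f-image of one of its rays embeds Omega_E(G) in |T|, and the image contains every
   end of T, because in a connected graph every Cauchy sequence of vertices converges
   to a vertex or is equivalent to a ray.
   Given T and X, let G arise from T by attaching an infinite clique to each vertex
   of T in X, and let f contract the cliques.
   Given G, build T from regions. Choose a vertex x of the current region C, nearest
   to a fixed root, and discard all vertices that are edge-inseparable from x. The rest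
   of C is partitioned into regions, the children of C, such that every finite cut
   avoiding x meets only finitely many of them. Each vertex is discarded after finitely
   many steps, and f maps it to the region where this happens. *)

Set Implicit Arguments.
Unset Strict Implicit.
Unset Printing Implicit Defensive.

Local Open Scope classical_set_scope.

(** * Topology *)

HB.instance Definition _ (G : graph) := gen_eqMixin (vtx G).
HB.instance Definition _ (G : graph) := gen_choiceMixin (vtx G).

Section SubbaseTopology.
Variable G : graph.

Lemma open_OmegaE (C : set (vtx G)) : is_region C -> open (OmegaE C : set (edge_end G)).
Proof.
move=> hC; exists [set OmegaE C]; last by rewrite bigcup_set1.
move=> _ ->; exists [fset C]%fset; first by move=> D /fset1P ->; exact/mem_set.
by rewrite set_fset1 bigcap_set1.
Qed.

Lemma open_vendC (C : set (vtx G)) : is_region C -> open (vendC C : set (vend G)).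
Proof.
move=> hC; exists [set vendC C]; last by rewrite bigcup_set1.
move=> _ ->; exists [fset C]%fset; first by move=> D /fset1P ->; exact/mem_set.
by rewrite set_fset1 bigcap_set1.
Qed.

Lemma continuous_to_edge_end (Z : topologicalType) (h : Z -> edge_end G) :
  (forall C, is_region C -> open (h @^-1` OmegaE C)) -> continuous h.
Proof.
move=> hop; apply/continuousP => _ [U subU <-].
rewrite preimage_bigcup; apply: bigcup_open => W /subU[S sS <-].
rewrite openE => z hz; apply: filter_bigI => C CS.
by apply: open_nbhs_nbhs; split; [exact/hop/set_mem/sS | exact: hz].
Qed.

Lemma continuous_to_vend (Z : topologicalType) (h : Z -> vend G) :
  (forall C, is_region C -> open (h @^-1` vendC C)) -> continuous h.
Proof.
move=> hop; apply/continuousP => _ [U subU <-].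
rewrite preimage_bigcup; apply: bigcup_open => W /subU[S sS <-].
rewrite openE => z hz; apply: filter_bigI => C CS.
by apply: open_nbhs_nbhs; split; [exact/hop/set_mem/sS | exact: hz].
Qed.
End SubbaseTopology.

Lemma homeomorphic_trans (X Y Z : topologicalType) :
  homeomorphic X Y -> homeomorphic Y Z -> homeomorphic X Z.
Proof.
move=> [f [g [fK gK cf cg]]] [f' [g' [fK' gK' cf' cg']]].
exists (f' \o f), (g \o g'); split.
- exact: can_comp.
- exact: can_comp.
- by move=> x; apply: continuous_comp; [exact: cf|exact: cf'].
- by move=> x; apply: continuous_comp; [exact: cg'|exact: cg].
Qed.

Lemma homeomorphic_sym (X Y : topologicalType) :
  homeomorphic X Y -> homeomorphic Y X.
Proof. by move=> [f [g [fK gK cf cg]]]; exists g, f. Qed.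

(** * Paths and components *)

Section Joined.
Variable V : Type.
Implicit Types (e : V -> V -> Prop) (x y z : V) (A : set V).

Lemma joined_refl e x : joined e x x.
Proof. by exists 0%N, (fun=> x). Qed.

Lemma joined1 e x y : e x y -> joined e x y.
Proof.
move=> exy; exists 1%N, (fun i => if i is 0%N then x else y); split=> //.
by case.
Qed.

Lemma joined_trans e x y z : joined e x y -> joined e y z -> joined e x z.
Proof.
move=> [n [p [p0 pn pe]]] [m [q [q0 qm qe]]].
exists (n + m)%N, (fun i => if (i <= n)%N then p i else q (i - n)%N); split => //.
- case: leqP => h; last by rewrite addKn.
  have m0 : m = 0%N by lia.
  by rewrite m0 addn0 pn -q0 -qm m0.
- move=> i im; case: (ltngtP i n) => h.
  + exact: pe.
  + by rewrite subSn ?(ltnW h)//; apply: qe; lia.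
  + by rewrite h pn -q0 subSnn; apply: qe; lia.
Qed.

Lemma joined_sym e x y : (forall u v, e u v -> e v u) -> joined e x y -> joined e y x.
Proof.
move=> esym [n [p [p0 pn pe]]]; exists n, (fun i => p (n - i)%N).
split; rewrite ?subn0 ?subnn// => i ilt; apply: esym.
have -> : (n - i = (n - i.+1).+1)%N by lia.
by apply: pe; lia.
Qed.

Lemma joined_ind e (P : V -> Prop) x y :
  P x -> (forall u v, joined e x u -> P u -> e u v -> P v) -> joined e x y -> P y.
Proof.
move=> Px IH [n [p [p0 pn pe]]].
suff : forall i, (i <= n)%N -> joined e x (p i) /\ P (p i).
  by move=> /(_ n (leqnn n)); rewrite pn => -[].
elim=> [|i IHi] ilt; first by rewrite p0; split=> //; exact: joined_refl.
have [ji Pi] := IHi (ltnW ilt).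
split; last exact: IH ji Pi (pe _ ilt).
exact: joined_trans ji (joined1 (pe _ ilt)).
Qed.

Lemma joined_sub e e' x y :
  (forall u v, e u v -> joined e' u v) -> joined e x y -> joined e' x y.
Proof.
move=> sub; apply: joined_ind; first exact: joined_refl.
by move=> u v _ xu /sub; exact: joined_trans.
Qed.

(** Stop where the walk first leaves [A]. That the earlier part stays inside [A] is recorded, so
    that [a] is known to lie in the component of [x]. *)
Lemma joined_exit e A x y : joined e x y -> A x -> ~ A y ->
  exists a b, [/\ joined (fun u v => [/\ A u, A v & e u v]) x a, A a, ~ A b & e a b].
Proof.
move=> xy Ax nAy; apply: contrapT => nex; apply: nAy.
suff [] : joined (fun u v => [/\ A u, A v & e u v]) x y /\ A y by [].
move: xy; pose e' u v := [/\ A u, A v & e u v].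
apply: (joined_ind (P := fun z => joined e' x z /\ A z)).
  by split=> //; exact: joined_refl.
move=> u v _ [xu Au] euv; have [Av|nAv] := pselect (A v); last first.
  by case: nex; exists u, v.
by split=> //; apply: joined_trans xu (joined1 _).
Qed.

(** A shortest walk is simple: a stretch between two visits to the same vertex could be dropped. *)
Lemma joined_simple e x y : joined e x y ->
  exists n p, [/\ p 0%N = x, p n = y, forall i, (i < n)%N -> e (p i) (p i.+1) &
    forall i j, (i <= n)%N -> (j <= n)%N -> p i = p j -> i = j].
Proof.
move=> xy.
pose P n := `[< exists p : nat -> V,
  [/\ p 0%N = x, p n = y & forall i, (i < n)%N -> e (p i) (p i.+1)] >].
have exP : exists n, P n by have [n [p h]] := xy; exists n; apply/asboolP; exists p.
case: (ex_minnP exP) => n /asboolP[p [p0 pn pe]] nmin.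
exists n, p; split => //.
suff H : forall i j, (i < j)%N -> (j <= n)%N -> p i <> p j.
  move=> i j ile jle pij; case: (ltngtP i j) => // h.
  - by case: (H _ _ h jle).
  - by case: (H _ _ h ile).
move=> i j ij jn pij.
suff : P (n - (j - i))%N by move=> /nmin; lia.
apply/asboolP; exists (fun k => if (k <= i)%N then p k else p (k + (j - i))%N); split.
- by rewrite leq0n.
- case: leqP => h; last by rewrite subnK; [|lia].
  have jn' : j = n by lia.
  have -> : (n - (j - i) = i)%N by lia.
  by rewrite pij jn' pn.
- move=> k kn; case: (ltngtP k i) => h.
  + by apply: pe; lia.
  + by rewrite addSn; apply: pe; lia.
  + rewrite h pij; have -> : (i.+1 + (j - i) = j.+1)%N by lia.
    by apply: pe; lia.
Qed.
End Joined.

(** * Components and their finite boundaries *)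

Section Components.
Variable G : graph.
Implicit Types (A C : set (vtx G)) (F : set (vtx G * vtx G)) (u v x y : vtx G).

Definition inside A u v := [/\ A u, A v & adj u v].

Lemma inside_sym A u v : inside A u v -> inside A v u.
Proof. by move=> [Au Av /adj_sym]. Qed.

Lemma adj_minus_sym F u v : adj_minus F u v -> adj_minus F v u.
Proof. by move=> [/adj_sym ? []]. Qed.

Lemma joinedm_sym F u v : joined (adj_minus F) u v -> joined (adj_minus F) v u.
Proof. by apply: joined_sym; exact: adj_minus_sym. Qed.

Lemma joinedm_subset F F' u v : F `<=` F' ->
  joined (adj_minus F') u v -> joined (adj_minus F) u v.
Proof.
move=> sub; apply: joined_sub => a b [ab [n1 n2]].
by apply: joined1; split=> //; split=> /sub.
Qed.

Lemma joined_inside_subset A C u v : A `<=` C ->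
  joined (inside A) u v -> joined (inside C) u v.
Proof. by move=> sub; apply: joined_sub => a b [/sub Ca /sub Cb ab]; apply: joined1. Qed.

Lemma joined_inside_mem A u v : A u -> joined (inside A) u v -> A v.
Proof. by move=> Au; apply: joined_ind => // a b _ _ []. Qed.

Lemma joined_inside_minus F A u v : (forall a b, A a -> A b -> ~ F (a, b)) ->
  joined (inside A) u v -> joined (adj_minus F) u v.
Proof.
move=> AF; apply: joined_sub => a b [Aa Ab ab]; apply: joined1; split=> //.
by split; apply: AF.
Qed.

Lemma joined_minus_boundary A u v :
  joined (adj_minus (boundary A)) u v -> A u -> A v.
Proof.
move=> uv Au; apply: contrapT => nAv.
by have [a [b [_ Aa nAb [ab []]]]] := joined_exit uv Au nAv; case.
Qed.

Lemma boundary_setT : boundary [set: vtx G] = set0.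
Proof. by rewrite -subset0 => -[a b] []. Qed.

Lemma boundary_setC A : boundary (~` A) = [set xy | boundary A (xy.2, xy.1)].
Proof.
apply/seteqP; split => -[a b] [/=].
- by move=> nA /contrapT Ab /adj_sym.
- by move=> Ab nA /adj_sym ab; split.
Qed.

Lemma finite_swap F : finite_set F -> finite_set [set xy | F (xy.2, xy.1)].
Proof.
move=> fF; apply: (@sub_finite_set _ _ ((fun xy => (xy.2, xy.1)) @` F)); last exact: finite_image.
by move=> [a b] /= Fba; exists (b, a).
Qed.

Lemma finite_boundaryC A : finite_set (boundary A) -> finite_set (boundary (~` A)).
Proof. by rewrite boundary_setC; exact: finite_swap. Qed.

Lemma finite_boundaryI A C : finite_set (boundary A) -> finite_set (boundary C) ->
  finite_set (boundary (A `&` C)).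
Proof.
move=> fA fC; apply: (@sub_finite_set _ _ (boundary A `|` boundary C)); last by rewrite finite_setU.
move=> [a b] [/= [Aa Ca] nAC ab].
by have [Ab|nAb] := pselect (A b); [right; split=> // Cb; apply: nAC|left].
Qed.

Definition edge_comp F x : set (vtx G) := [set y | joined (adj_minus F) x y].

Lemma boundary_comp F x : boundary (edge_comp F x) `<=` F `|` [set xy | F (xy.2, xy.1)].
Proof.
move=> [a b] [/= xa nxb ab]; apply: contrapT => /not_orP[/= n1 n2].
by apply: nxb; apply: joined_trans xa (joined1 _).
Qed.

Lemma finite_boundary_comp F x : finite_set F -> finite_set (boundary (edge_comp F x)).
Proof.
move=> fF; apply: sub_finite_set (@boundary_comp F x) _.
by rewrite finite_setU; split=> //; exact: finite_swap.
Qed.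

Lemma joined_inside_comp F x y : edge_comp F x y -> joined (inside (edge_comp F x)) x y.
Proof.
apply: joined_ind; first exact: joined_refl.
move=> u v xu xu' uv; apply: joined_trans xu' (joined1 _).
split => //; [exact: joined_trans xu (joined1 uv)|by case: uv].
Qed.

Lemma joined_inside_sym A u v : joined (inside A) u v -> joined (inside A) v u.
Proof. by apply: joined_sym; exact: inside_sym. Qed.

Lemma region_comp F x : finite_set F -> is_region (edge_comp F x).
Proof.
move=> fF; split; first by exists x; exact: joined_refl.
- move=> u v /joined_inside_comp xu /joined_inside_comp.
  exact: joined_trans (joined_inside_sym xu).
- exact: finite_boundary_comp.
Qed.

Definition comp_in A x : set (vtx G) := [set y | joined (inside A) x y].

Lemma comp_in_subset A x : A x -> comp_in A x `<=` A.
Proof. by move=> Ax y; exact: joined_inside_mem. Qed.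

Lemma joined_inside_comp_in A x y : comp_in A x y -> joined (inside (comp_in A x)) x y.
Proof.
apply: joined_ind; first exact: joined_refl.
move=> u v xu xu' uv; apply: joined_trans xu' (joined1 _).
split => //; [exact: joined_trans xu (joined1 uv)|by case: uv].
Qed.

Lemma region_comp_in A x : A x -> finite_set (boundary A) -> is_region (comp_in A x).
Proof.
move=> Ax fA; split; first by exists x; exact: joined_refl.
- move=> u v /joined_inside_comp_in xu /joined_inside_comp_in.
  exact: joined_trans (joined_inside_sym xu).
- apply: sub_finite_set fA => -[a b] [/= xa nxb ab].
  have Aa := comp_in_subset Ax xa; split=> // Ab.
  by apply: nxb; apply: joined_trans xa (joined1 _).
Qed.

Lemma comp_in_eq A x y : comp_in A x y -> comp_in A y = comp_in A x.
Proof.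
move=> xy; apply/seteqP; split => z; first exact: joined_trans.
exact: joined_trans (joined_inside_sym xy).
Qed.

(** A walk to [x0] leaves any component that misses [x0], and it does so by an edge of [boundary A].
    So each such component contains the inner end of one of finitely many edges. *)
Lemma finite_comp_in A : connected_graph G -> finite_set (boundary A) ->
  finite_set [set comp_in A x | x in A].
Proof.
move=> [_ Gc] fA; have [[x0 Ax0]|A0] := pselect (A !=set0); last first.
  by apply: sub_finite_set (@finite_set0 (set (vtx G))); move=> t [x Ax _]; case: A0; exists x.
apply: (@sub_finite_set _ _ (comp_in A @` (x0 |` (fst @` boundary A)))).
  move=> _ [x Ax <-].
  have [h|h] := pselect (comp_in A x0 x).
    by exists x0; [left|rewrite (comp_in_eq h)].
  have [a [b [_ xa' xb ab]]] :=
    joined_exit (Gc x x0) (joined_refl _ _ : comp_in A x x) (h \o @joined_inside_sym _ _ _).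
  have Aa := comp_in_subset Ax xa'.
  exists a; last exact: comp_in_eq xa'.
  right; exists (a, b) => //; split=> // Ab.
  by apply: xb; apply: joined_trans xa' (joined1 _).
by apply: finite_image; rewrite finite_setU; split; [exact: finite_set1|exact: finite_image].
Qed.
End Components.

(** * Cauchy sequences of vertices *)

Lemma finite_eventually (T : eqType) (W : set T) (Q : T -> nat -> Prop) :
  finite_set W -> (forall w, W w -> exists N, forall n, (N <= n)%N -> Q w n) ->
  exists N, forall w, W w -> forall n, (N <= n)%N -> Q w n.
Proof.
move=> /finite_seqP[s ->]; elim: s => [|a s IH] h; first by exists 0%N.
have [|N hN] := IH; first by move=> w /= ws; apply: h; rewrite /= inE ws orbT.
have [M hM] := h a (mem_head _ _).
exists (maxn N M) => w /=; rewrite inE => /orP[/eqP -> n|ws n]; rewrite geq_max => /andP[n1 n2].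
- exact: hM.
- exact: hN.
Qed.

Lemma injective_leaves_finite (T : eqType) (W : set T) (r : nat -> T) :
  injective r -> finite_set W ->
  exists N, forall w, W w -> forall n, (N <= n)%N -> r n <> w.
Proof.
move=> inj fW; apply: (finite_eventually (Q := fun w n => r n <> w)) => // w _.
have [[m <-]|nm] := pselect (exists m, r m = w); last first.
  by exists 0%N => n _ rn; apply: nm; exists n.
by exists m.+1 => n mn /inj nm; rewrite nm ltnn in mn.
Qed.

Lemma sval_inj (T : Type) (P : T -> Prop) : injective (@sval T P).
Proof. by move=> [a pa] [b pb] /= ab; exact: eq_exist. Qed.

Section Walks.
Variable V : Type.

Lemma joined_tail (e : V -> V -> Prop) (r : nat -> V) N :
  (forall n, (N <= n)%N -> e (r n) (r n.+1)) ->
  forall i j, (N <= i)%N -> (i <= j)%N -> joined e (r i) (r j).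
Proof.
move=> er i j Ni /subnKC <-; elim: (j - i)%N => [|d IH].
  by rewrite addn0; exact: joined_refl.
apply: joined_trans IH (joined1 _); rewrite addnS; apply: er; lia.
Qed.

(** Concatenates walks from [c n] to [c n.+1]; [k i] is the block containing step [i]. The condition
    [c n <> c n.+1] rules out blocks without a step. *)
Lemma walk_of_blocks (E : nat -> V -> V -> Prop) (c : nat -> V) :
  (forall n, joined (E n) (c n) (c n.+1)) -> (forall n, c n <> c n.+1) ->
  exists (w : nat -> V) (k : nat -> nat),
    (forall i, E (k i) (w i) (w i.+1)) /\
    (forall n, exists N, forall i, (N <= i)%N -> (n <= k i)%N).
Proof.
move=> /choice[l /choice[p ph]] cn.
have l0 n : (0 < l n)%N.
  by case: (ph n) => p0 pl _; case: (l n) pl => // h; case: (cn n); rewrite -p0 -h.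
pose step (s : nat * nat) := if (s.2.+1 < l s.1)%N then (s.1, s.2.+1) else (s.1.+1, 0%N).
pose st i := iter i step (0%N, 0%N).
have st_lt i : ((st i).2 < l (st i).1)%N.
  by elim: i => [|i IH] /=; [exact: l0|rewrite /step; case: ifP].
exists (fun i => p (st i).1 (st i).2), (fun i => (st i).1); split.
- move=> i; rewrite /= /step; have := st_lt i; case: (st i) => n j /= jl.
  have [_ pl pe] := ph n; have := pe _ jl.
  case: ifP => // jl'; have <- : l n = j.+1 by lia.
  by rewrite pl; have [-> _ _] := ph n.+1.
- have mono i : ((st i).1 <= (st i.+1).1)%N by rewrite /= /step; case: ifP => //=.
  have grow d i : (l (st i).1 - (st i).2 <= d)%N -> exists j, ((st i).1 < (st j).1)%N.
    elim: d i => [|d IH] i h; first by have := st_lt i; lia.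
    have [/IH[j]|] := leqP (l (st i.+1).1 - (st i.+1).2) d.
      by move=> /(leq_ltn_trans (mono i)); exists j.
    by move=> h'; exists i.+1; move: h h'; rewrite /= /step; case: ifP => //=; lia.
  elim=> [|n [N hN]]; first by exists 0%N.
  have [j hj] := grow _ _ (leqnn (l (st N).1 - (st N).2)).
  exists j => i ij; apply: (leq_trans (leq_ltn_trans (hN _ (leqnn _)) hj)).
  by rewrite -(subnKC ij); elim: (i - j)%N => [|m IH]; rewrite ?addn0// addnS (leq_trans IH).
Qed.

(* The path follows the walk, jumping from each vertex to the last visit of the walk to it. *)
Lemma path_of_walk (e : V -> V -> Prop) (w : nat -> V) :
  (forall i, e (w i) (w i.+1)) ->
  (forall v, exists M, forall j, (M <= j)%N -> w j <> v) ->
  exists t : nat -> nat, [/\ forall i, (i <= t i)%N, injective (w \o t) &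
    forall i, e (w (t i)) (w (t i.+1))].
Proof.
move=> we wfin.
have /choice[L hL] : forall i, exists j, w j = w i /\ forall m, (j < m)%N -> w m <> w i.
  move=> i; have [M hM] := wfin (w i).
  have ex : exists j, `[< w j = w i >] by exists i; apply/asboolP.
  have ub j : `[< w j = w i >] -> (j <= M)%N.
    by move=> /asboolP wj; rewrite leqNgt; apply/negP => /ltnW /hM.
  case: (ex_maxnP ex ub) => j /asboolP wj jmax; exists j; split=> // m jm wm.
  by have := jmax m (asboolT wm); lia.
have Lge i : (i <= L i)%N by have [_ h] := hL i; rewrite leqNgt; apply/negP => /h.
pose t i := iter i (fun m => L m.+1) (L 0%N).
have tlast i m : (t i < m)%N -> w m <> w (t i).
  by case: i => [|i] /=; [have [-> ] := hL 0%N|have [-> ] := hL (t i).+1]; apply.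
have tS i : (t i < t i.+1)%N by rewrite /= (leq_trans _ (Lge _)).
have tmono i d : (t i < t (i + d.+1))%N.
  by elim: d => [|d IH]; rewrite addnS ?addn0 ?tS// (ltn_trans IH).
exists t; split.
- by elim=> // i IH; exact: leq_ltn_trans IH (tS i).
- move=> i j /= wij; case: (ltngtP i j) => // h; exfalso.
  + apply: (@tlast i (t j)) => //; have := tmono i (j - i).-1.
    by rewrite prednK ?subn_gt0// subnKC// ltnW.
  + apply: (@tlast j (t i)) => //; have := tmono j (i - j).-1.
    by rewrite prednK ?subn_gt0// subnKC// ltnW.
- by move=> i /=; have [-> _] := hL (t i).+1; exact: we.
Qed.
End Walks.

(** * Convergence with respect to finite edge separators *)

Section Closeness.
Variable G : graph.
Implicit Types (g h : nat -> vtx G) (u v : vtx G).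

(** Equivalence of Cauchy sequences: [edge_close g g] says that [g] is Cauchy, and
    [edge_close (fun=> v) g] that it converges to [v]. *)
Definition edge_close g h := forall F : set (vtx G * vtx G), finite_set F ->
  exists N, forall i j, (N <= i)%N -> (N <= j)%N -> joined (adj_minus F) (g i) (h j).

Lemma edge_close_sym g h : edge_close g h -> edge_close h g.
Proof.
by move=> gh F /gh[N hN]; exists N => i j Ni Nj; apply: joinedm_sym; exact: hN.
Qed.

Lemma edge_close_trans g h k : edge_close g h -> edge_close h k -> edge_close g k.
Proof.
move=> gh hk F fF; have [N hN] := gh _ fF; have [M hM] := hk _ fF.
exists (maxn N M) => i j; rewrite !geq_max => /andP[Ni Mi] /andP[Nj Mj].
by apply: joined_trans (hN _ _ Ni Ni) (hM _ _ Mi Mj).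
Qed.

Lemma edge_equivE (r r' : ray G) : edge_equiv r r' <-> edge_close (sval r) (sval r').
Proof.
split=> h F /h; last by move=> [N hN]; exists N, N.
move=> [n [m nm]]; exists (maxn n m) => i j; rewrite !geq_max => /andP[ni _] /andP[_ mj].
exact: nm.
Qed.

(** The edges of a ray are distinct, so a finite [F] misses all of them from some point on. Both
    orientations must be treated, as [F] consists of ordered pairs. *)
Lemma ray_close (r : ray G) : edge_close (sval r) (sval r).
Proof.
case: r => r [rinj radj] /= F fF.
pose e n := (r n, r n.+1).
have einj : injective e by move=> i j [/rinj].
have [N hN] := injective_leaves_finite einj fF.
have einj' : injective (fun n => ((r n.+1, r n) : vtx G * vtx G)) by move=> i j [_ /rinj].
have [M hM] := injective_leaves_finite einj' fF.
have tl n : (maxn N M <= n)%N -> adj_minus F (r n) (r n.+1).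
  rewrite geq_max => /andP[Nn Mn]; split=> //; split=> Fn.
  - exact: hN Fn _ Nn erefl.
  - exact: hM Fn _ Mn erefl.
exists (maxn N M) => i j hi hj; have [ij|/ltnW ij] := leqP i j.
- exact: joined_tail tl _ _ hi ij.
- exact/joinedm_sym/(joined_tail tl).
Qed.

Definition end_of (r : ray G) : edge_end G :=
  exist _ [set r' | edge_equiv r r'] (ex_intro _ r erefl).

Lemma end_of_mem (r : ray G) : sval (end_of r) r.
Proof. exact/edge_equivE/ray_close. Qed.

Lemma mem_end (w : edge_end G) (r r' : ray G) :
  sval w r -> sval w r' <-> edge_close (sval r) (sval r').
Proof.
case: w => A [r0 hA] /=; rewrite hA => /edge_equivE h; rewrite /= edge_equivE; split => h'.
- exact: edge_close_trans (edge_close_sym h) h'.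
- exact: edge_close_trans h h'.
Qed.

Lemma end_ex (w : edge_end G) : exists r, sval w r.
Proof. by case: w => A [r hA]; exists r; rewrite /= hA; exact: end_of_mem. Qed.

Lemma end_eq (w w' : edge_end G) (r r' : ray G) :
  sval w r -> sval w' r' -> edge_close (sval r) (sval r') -> w = w'.
Proof.
move=> wr wr' rr'; apply: sval_inj; apply/seteqP; split => s.
- move=> /(mem_end s wr) rs; apply/(mem_end s wr').
  exact: edge_close_trans (edge_close_sym rr') rs.
- move=> /(mem_end s wr') rs; apply/(mem_end s wr).
  exact: edge_close_trans rr' rs.
Qed.

(** Convergence phrased without the topology; [vendC_tends] links it to the basic open sets. *)
Definition tends g (z : vend G) := match z with
  | inl v => edge_close (fun=> v) g
  | inr w => exists t, sval w t /\ edge_close (sval t) g end.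
End Closeness.

Lemma decreasing_subset (T : Type) (C : nat -> set T) :
  (forall n, C n.+1 `<=` C n) -> forall n m, (n <= m)%N -> C m `<=` C n.
Proof.
move=> CS n m /subnKC <-; elim: (m - n)%N => [|d IH]; first by rewrite addn0.
by rewrite addnS; apply: subset_trans (CS _) IH.
Qed.


Section Completeness.
Variables (G : graph) (g : nat -> vtx G).
Hypotheses (Gc : connected_graph G) (gC : edge_close g g) (gv : forall v, ~ edge_close (fun=> v) g).
Implicit Types (F : set (vtx G * vtx G)) (u v : vtx G).

(** For finite [F], this is the component of [G - F] in which [g] eventually stays (see [dirE]). *)
Let dir F : set (vtx G) := [set u | exists N, forall i, (N <= i)%N -> joined (adj_minus F) u (g i)].

Let dir_mem F : finite_set F -> exists u, dir F u.
Proof. by move=> fF; have [N hN] := gC fF; exists (g N), N => i; apply: hN. Qed.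

Let dir_joined F u v : dir F u -> dir F v -> joined (adj_minus F) u v.
Proof.
move=> [N hN] [M hM]; apply: joined_trans (hN (N + M)%N (leq_addr _ _)) _.
exact/joinedm_sym/hM/leq_addl.
Qed.

Let dirE F u : dir F u -> dir F = edge_comp F u.
Proof.
move=> du; apply/seteqP; split => v; first exact: dir_joined.
move=> uv; have [N hN] := du; exists N => i /hN.
exact: joined_trans (joinedm_sym uv).
Qed.

Let dirS F F' : F `<=` F' -> dir F' `<=` dir F.
Proof. by move=> FF' u [N hN]; exists N => i /hN; exact: joinedm_subset. Qed.

(** As [g] converges to no vertex, each vertex is cut off from the tail of [g] by some finite set;
    the union of these sets serves all of [s]. *)
Let sep (s : seq (vtx G)) : exists E : seq (vtx G * vtx G), forall v, v \in s -> ~ dir [set` E] v.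
Proof.
elim: s => [|a s [E hE]]; first by exists [::].
have [F /finite_seqP[E' FE'] ndF] : exists2 F, finite_set F & ~ dir F a.
  apply: contrapT => h; apply: (@gv a) => F fF.
  have [N hN] : dir F a by apply: contrapT => nd; apply: h; exists F.
  by exists N => i j _; exact: hN.
exists (E ++ E') => v; rewrite inE => /orP[/eqP ->|vs].
- by move=> d; apply: ndF; rewrite FE'; apply: dirS d => e /= eE; rewrite mem_cat eE orbT.
- by move=> d; apply: (hE v vs); apply: dirS d => e /= eE; rewrite mem_cat eE.
Qed.

Let ends_of (E : seq (vtx G * vtx G)) := map fst E ++ map snd E.

(* The direction of [g] is followed by regions [C n] such that no endpoint of a boundary
   edge of [C n] lies in [C n.+1]. A path entering all [C n] would need a new boundary edge
   for each of them, so their intersection is empty, and a walk passing through all of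
   them visits each vertex only finitely often. *)
Lemma ray_of_cauchy : exists r : ray G, edge_close (sval r) g.
Proof.
have fE (E : seq (vtx G * vtx G)) : finite_set [set` E] by apply/finite_seqP; exists E.
have [pt ptP] := choice (fun E => dir_mem (fE E)).
(* The vertex [pt E] is cut off as well, so that consecutive vertices [c n] differ, as
   [walk_of_blocks] requires. *)
have nxt_ex (E : seq (vtx G * vtx G)) : exists E' : seq (vtx G * vtx G),
    (forall e, e \in E -> e \in E') /\
    forall v, v \in pt E :: ends_of E -> ~ dir [set` E'] v.
  have [E' hE'] := sep (pt E :: ends_of E); exists (E ++ E'); split.
    by move=> e eE; rewrite mem_cat eE.
  move=> v /hE' nd d; apply: nd; apply: dirS d => e /= eE.
  by rewrite mem_cat eE orbT.
have [nxt nxtP] := choice nxt_ex.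
pose E n := iter n nxt [::].
pose C n := dir [set` E n].
pose c n := pt (E n).
have Cc n : C n (c n) by exact: ptP.
have CS n : C n.+1 `<=` C n.
  by apply: dirS => e; have [sub _] := nxtP (E n); exact: sub.
have Cmono := decreasing_subset CS.
have Cend n a b : (a, b) \in E n -> ~ C n.+1 a /\ ~ C n.+1 b.
  move=> ab; have [_ h] := nxtP (E n).
  by split; apply: h; rewrite inE mem_cat; apply/orP; right; apply/orP;
    [left|right]; apply/mapP; exists (a, b).
have ncS n : ~ C n.+1 (c n) by have [_ h] := nxtP (E n); apply: h; exact: mem_head.
have Cexit n a b : adj a b -> ~ C n a -> C n b -> ~ C n.+1 b.
  move=> ab nCa Cb; have [|/negP h1] := boolP ((a, b) \in E n).
    by move=> /Cend[].
  have [|/negP h2] := boolP ((b, a) \in E n); first by move=> /Cend[].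
  case: nCa; rewrite /C (dirE Cb); apply: joined1; split; last by split.
  exact: adj_sym.
have Cempty v : exists n, ~ C n v.
  apply: contrapT => /forallNP/(_ _)/contrapT Cv.
  have [_ /(_ (c 0%N) v)[l [p [p0 pl pe]]]] := Gc.
  suff H n : exists i, [/\ (n <= i)%N, (i <= l)%N & ~ C n.+1 (p i)].
    by have [i [h1 h2]] := H l.+1; lia.
  elim: n => [|n [i [ni il nCi]]]; first by exists 0%N; rewrite p0.
  have [j [ij jl nCj Cj]] : exists j, [/\ (i <= j)%N, (j < l)%N, ~ C n.+1 (p j) & C n.+1 (p j.+1)].
    apply: contrapT => nex.
    suff : ~ C n.+1 (p l) by rewrite pl.
    suff H d : (i + d <= l)%N -> ~ C n.+1 (p (i + d)%N).
      by rewrite -(subnKC il); apply: H; rewrite subnKC.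
    elim: d => [|d IH]; rewrite ?addn0// addnS => dl Cd; apply: nex.
    by exists (i + d)%N; split; [lia|lia|apply: IH; lia|].
  exists j.+1; split; [lia|by []|].
  exact: Cexit (pe _ jl) nCj Cj.
have ev v : exists N, forall n, (N <= n)%N -> ~ C n v.
  by have [N nC] := Cempty v; exists N => n /Cmono Cn /Cn.
have [w [k [wE kinf]]] : exists (w : nat -> vtx G) (k : nat -> nat),
    (forall i, inside (C (k i)) (w i) (w i.+1)) /\
    (forall n, exists N, forall i, (N <= i)%N -> (n <= k i)%N).
  apply: (walk_of_blocks (E := fun n => inside (C n)) (c := c)).
    move=> n; rewrite /C (dirE (Cc n)); apply: joined_inside_comp.
    by apply: dir_joined; [exact: Cc|exact/CS/Cc].
  by move=> n cn; apply: (ncS n); rewrite cn; exact: Cc.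
have wC n : exists N, forall i, (N <= i)%N -> inside (C n) (w i) (w i.+1).
  have [N hN] := kinf n; exists N => i /hN ni.
  by have [h1 h2 h3] := wE i; split => //; exact: Cmono ni _ _.
have [t [ti tinj tadj]] : exists t : nat -> nat,
  [/\ forall i, (i <= t i)%N, injective (w \o t) & forall i, adj (w (t i)) (w (t i.+1))].
  apply: path_of_walk; first by move=> i; have [] := wE i.
  move=> v; have [n nCv] := Cempty v; have [N hN] := wC n.
  by exists N => j /hN[Cj _ _] wv; apply: nCv; rewrite -wv.
exists (exist _ (w \o t) (conj tinj tadj)) => F fF /=.
(* From stage [n] on, the regions contain no endpoint of [F], so walks inside [C n] avoid [F]; both
   the ray and [g] end up in [C n]. *)
have [n hn] : exists n, forall v, [set x | exists2 e, F e & x = e.1 \/ x = e.2] v ->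
    forall m, (n <= m)%N -> ~ C m v.
  apply: (finite_eventually (Q := fun v m => ~ C m v)) => //.
  apply: (@sub_finite_set _ _ ((fst @` F) `|` (snd @` F))).
    by move=> x [e Fe [->|->]]; [left|right]; exists e.
  by rewrite finite_setU; split; exact: finite_image.
have [N hN] := wC n; have [M hM] := gC (fE (E n)).
exists (maxn N M) => i j; rewrite !geq_max => /andP[Ni Mi] /andP[Nj Mj].
have Cw : C n (w (t i)) by have [] := hN _ (leq_trans Ni (ti i)).
have Cg : C n (g j) by exists M => m Mm; exact: hM.
apply: (@joined_inside_minus _ F (C n)).
  by move=> a b Ca _ Fab; apply: (hn a _ n (leqnn n) Ca); exists (a, b) => //; left.
by move: Cg; rewrite /C (dirE Cw); exact: joined_inside_comp.
Qed.
End Completeness.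

(** * Limits in trees *)

Section Trees.
Variable T : graph.
Implicit Types (u v a b : vtx T).

(** A simple walk from [a] to [b] avoiding the edge [ab] has at least two edges and closes up with
    [ab] to a cycle. *)
Lemma tree_bridge a b : is_tree T -> adj a b -> ~ joined (adj_minus [set (a, b)]) a b.
Proof.
move=> [_ nocycle] ab ajb; apply: nocycle.
have [n [p [p0 pn pe pinj]]] := joined_simple ajb.
exists n.+1, p; split.
- rewrite ltnS ltn_neqAle lt0n; apply/andP; split; apply/negP => /eqP n0.
  + have [|_ []] := pe 0%N; first by rewrite -n0.
    by move=> h _; apply: h; rewrite /= p0 n0 pn.
  + by move: ab; rewrite -{1}p0 -n0 pn => /adj_irrefl.
- by move=> i j ilt jlt; apply: pinj.
- by move=> i /pe [].
- by rewrite /= pn p0; exact: adj_sym.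
Qed.

(** [b] is the second vertex of a simple path from [u] to [v]. The rest of the path avoids the edge
    [ub], so another connection from [u] to [v] would join the ends of a bridge. *)
Lemma tree_separated u v : is_tree T -> u <> v ->
  exists2 b, adj u b & ~ joined (adj_minus [set (u, b)]) u v.
Proof.
move=> hT uv; have [[_ Tc] _] := hT.
have [n [p [p0 pn pe pinj]]] := joined_simple (Tc u v).
have n0 : (0 < n)%N by case: n pn {pe pinj} => // pn; case: uv; rewrite -p0 -pn.
have up1 : adj u (p 1%N) by rewrite -{1}p0; exact: pe.
exists (p 1%N) => //.
move=> j; apply: (tree_bridge hT up1); apply: joined_trans j _; apply: joinedm_sym.
have tl i : (1 <= i)%N -> (i < n)%N -> adj_minus [set (u, p 1%N)] (p i) (p i.+1).
  move=> i1 ilt; split; [exact: pe|split=> /= -[]].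
  - by rewrite -p0 => /pinj h _; move: h; rewrite leq0n ltnW// => /(_ isT isT) h; rewrite h in i1.
  - by rewrite -p0 => /pinj h _; move: h; rewrite leq0n ilt => /(_ isT isT).
rewrite -pn; have -> : n = (n.-1 + 1)%N by lia.
have : (n.-1 < n)%N by lia.
elim: n.-1 => [|m IH] mn; first exact: joined_refl.
apply: joined_trans (IH _) (joined1 _); first lia.
by rewrite addSn addn1; apply: tl; lia.
Qed.

(** Take an edge from [t N] to [t N.+1] beyond all visits of the ray to a fixed path from [t 0] to
    [v]. Without it, [v] is still joined to [t N] and the tail to [t N.+1]; joining [v] to the tail
    would contradict [tree_bridge]. *)
Lemma tree_ray_no_vertex v (t : ray T) : is_tree T -> ~ edge_close (fun=> v) (sval t).
Proof.
case: t => t [tinj tadj] /= hT vt.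
have [[_ Tc] _] := hT; have [l [p [p0 pl pe]]] := Tc (t 0%N) v.
have [N hN] : exists N, forall w, (p @` `I_l.+1) w -> forall n, (N <= n)%N -> t n <> w.
  by apply: injective_leaves_finite => //; apply: finite_image; exact: finite_II.
pose F := [set (t N, t N.+1)].
have [M hM] := vt F (finite_set1 _).
apply: (tree_bridge hT (tadj N)); rewrite -/F.
have j1 : joined (adj_minus F) (t 0%N) (t N).
  have tl i : (i < N)%N -> adj_minus F (t i) (t i.+1).
    by move=> iN; split=> //; split => /= -[/tinj h1 /tinj h2]; lia.
  suff H m : (m <= N)%N -> joined (adj_minus F) (t 0%N) (t m) by exact: H.
  elim: m => [_|m IH mN]; first exact: joined_refl.
  exact: joined_trans (IH (ltnW mN)) (joined1 (tl m mN)).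
have j2 : joined (adj_minus F) (t 0%N) v.
  exists l, p; split=> // i il; split; first exact: pe.
  by split=> -[h1 h2]; apply: (hN (t N) _ N (leqnn _)) => //; [exists i|exists i.+1] => //=; lia.
have j3 : joined (adj_minus F) v (t (M + N.+1)%N) by apply: (hM M); lia.
have j4 : joined (adj_minus F) (t N.+1) (t (M + N.+1)%N).
  apply: (joined_tail (N := N.+1)) => //; last lia.
  by move=> n Nn; split=> //; split => /= -[/tinj h1 /tinj h2]; lia.
apply: joined_trans (joinedm_sym j1) _; apply: joined_trans j2 _.
exact: joined_trans j3 (joinedm_sym j4).
Qed.
End Trees.

Section Limits.
Variable G : graph.
Implicit Types (g h : nat -> vtx G) (z : vend G) (C : set (vtx G)).

Lemma tail_ray (r : ray G) N : exists r' : ray G,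
  (forall n, sval r' n = sval r (N + n)%N) /\ edge_close (sval r) (sval r').
Proof.
have := ray_close r; case: r => r [rinj radj] /= rr.
have h : is_ray (fun n => r (N + n)%N).
  split; first by move=> i j /rinj; lia.
  by move=> n; rewrite addnS.
exists (exist _ _ h); split=> // F /rr[M hM]; exists M => i j Mi Mj /=.
by apply: hM => //; lia.
Qed.

Lemma tends_close g h z : tends g z -> edge_close g h -> tends h z.
Proof.
case: z => [v|w] /= gz gh; first exact: edge_close_trans gz gh.
by have [t [wt tg]] := gz; exists t; split=> //; exact: edge_close_trans tg gh.
Qed.

Lemma tends_unique_close g h z : tends g z -> tends h z -> edge_close g h.
Proof.
case: z => [v|w] /=; first by move=> /edge_close_sym; exact: edge_close_trans.
move=> [t [wt tg]] [s [ws sh]]; apply: edge_close_trans (edge_close_sym tg) _.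
by apply: edge_close_trans sh; apply/(mem_end s wt).
Qed.

Lemma tends_end (w : edge_end G) (r : ray G) : tends (sval r) (inr w) <-> sval w r.
Proof.
split=> [[t [wt tr]]|wr]; first exact/(mem_end r wt).
by exists r; split=> //; exact: ray_close.
Qed.

(** A single edge of a tree separates two given vertices, and a ray of a tree converges to no
    vertex. In other graphs, inseparable vertices are limits of the same sequences. *)
Lemma tree_tends_unique g z z' : is_tree G -> tends g z -> tends g z' -> z = z'.
Proof.
move=> hG; case: z => [v|w]; case: z' => [v'|w'] /=.
- move=> vg v'g; congr inl; apply: contrapT => /(tree_separated hG)[b _]; apply.
  have [N hN] := edge_close_trans vg (edge_close_sym v'g) (finite_set1 (v, b)).
  exact: hN (leqnn N) (leqnn N).
- move=> vg [t [_ tg]]; exfalso; apply: (tree_ray_no_vertex (v := v) (t := t) hG).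
  exact: edge_close_trans vg (edge_close_sym tg).
- move=> [t [_ tg]] vg; exfalso; apply: (tree_ray_no_vertex (v := v') (t := t) hG).
  exact: edge_close_trans vg (edge_close_sym tg).
- move=> [t [wt tg]] [s [ws sg]]; congr inr; apply: end_eq wt ws _.
  exact: edge_close_trans tg (edge_close_sym sg).
Qed.

(** A walk avoiding [boundary C] cannot cross it, so [g] is eventually on the same side as its
    limit. In the case of an end, passing to a tail gives the ray contained in [C] that [OmegaE]
    asks for. *)
Lemma vendC_tends C g z : finite_set (boundary C) -> tends g z ->
  vendC C z <-> exists N, forall n, (N <= n)%N -> C (g n).
Proof.
move=> fC; case: z => [v|w] /=.
- move=> vg; have [N hN] := vg _ fC; split => [Cv|[M hM]].
  + by exists N => n Nn; exact: joined_minus_boundary (hN _ _ (leqnn N) Nn) Cv.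
  + apply: (joined_minus_boundary (joinedm_sym (hN N (N + M)%N _ _))); try lia.
    by apply: hM; lia.
- move=> [t [wt tg]]; split => [[r [wr Cr]]|[M hM]].
  + have rt : edge_close (sval r) (sval t) by apply/(mem_end t wr).
    have [N hN] := edge_close_trans rt tg fC.
    by exists N => n Nn; exact: joined_minus_boundary (hN _ _ (leqnn N) Nn) (Cr N).
  + have [N hN] := tg _ fC.
    have Ct n : (N <= n)%N -> C (sval t n).
      move=> Nn; apply: (joined_minus_boundary (joinedm_sym (hN n (N + M)%N _ _))); try lia.
      by apply: hM; lia.
    have [r [rE tr]] := tail_ray t N; exists r; split; first exact/(mem_end r wt).
    by move=> n; rewrite rE; apply: Ct; lia.
Qed.

Lemma OmegaE_ray C (w : edge_end G) (r : ray G) : finite_set (boundary C) -> sval w r ->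
  OmegaE C w <-> exists N, forall n, (N <= n)%N -> C (sval r n).
Proof. by move=> fC wr; apply: (vendC_tends (z := inr w)) => //; exact/tends_end. Qed.

Lemma cauchy_tends g : connected_graph G -> edge_close g g -> exists z, tends g z.
Proof.
move=> Gc gg; have [[v vg]|gv] := pselect (exists v, edge_close (fun=> v) g).
  by exists (inl v).
have [|r rg] := ray_of_cauchy Gc gg; first by move=> v vg; apply: gv; exists v.
by exists (inr (end_of r)), r; split=> //; exact: end_of_mem.
Qed.
End Limits.

(** * Transfer of the end space along a uniform equivalence onto a tree *)

Section Transfer.
Variables (G T : graph) (f : vtx G -> vtx T).
Hypotheses (Gc : connected_graph G) (hT : is_tree T).
Hypothesis f_surj : forall c, exists u, f u = c.
Hypothesis f_cont : forall F' : set (vtx T * vtx T), finite_set F' ->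
  exists2 F : set (vtx G * vtx G), finite_set F &
    forall u v, joined (adj_minus F) u v -> joined (adj_minus F') (f u) (f v).
Hypothesis f_open : forall F : set (vtx G * vtx G), finite_set F ->
  exists2 F' : set (vtx T * vtx T), finite_set F' &
    forall u v, joined (adj_minus F') (f u) (f v) -> joined (adj_minus F) u v.

Definition limits : set (vend T) := [set z | exists r : ray G, tends (f \o sval r) z].

Lemma close_map g h : edge_close (f \o g) (f \o h) <-> edge_close g h.
Proof.
split=> gh F fF.
- have [F' fF' h'] := f_open fF; have [N hN] := gh _ fF'.
  by exists N => i j Ni Nj; apply: h'; exact: hN.
- have [F' fF' h'] := f_cont fF; have [N hN] := gh _ fF'.
  by exists N => i j Ni Nj; apply: h'; exact: hN.
Qed.

(** Lift a ray of the end to [G] vertex by vertex. The lift is Cauchy, so it converges; if its limit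
    were a vertex [v], the ray would converge to [f v], which [tree_ray_no_vertex] excludes. *)
Lemma ends_in_limits : @ends_in T `<=` limits.
Proof.
move=> _ [w _ <-]; have [t wt] := end_ex w.
have [g gt] := choice (fun n => f_surj (sval t n)).
have gtE : f \o g = sval t by apply/funext.
have gg : edge_close g g by apply/close_map; rewrite gtE; exact: ray_close.
have [z gz] := cauchy_tends Gc gg; case: z gz => [v|w'] /=.
  move/close_map; rewrite gtE => vt; exfalso.
  exact: (tree_ray_no_vertex (v := f v) (t := t) hT).
move=> [r [_ /close_map rg]]; exists r, t; split=> //.
by apply: edge_close_sym; rewrite -gtE.
Qed.

Lemma limits_homeomorphic : homeomorphic (edge_end G) (set_type limits).
Proof.
have ex1 (w : edge_end G) : exists x : set_type limits,
    forall r, sval w r -> tends (f \o sval r) (val x).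
  have [r wr] := end_ex w.
  have [|z rz] := cauchy_tends (g := f \o sval r) (proj1 hT).
    by apply/close_map; exact: ray_close.
  have zl : z \in limits by apply/mem_set; exists r.
  exists (exist _ z zl) => s ws; apply: tends_close rz _.
  by apply/close_map/(mem_end s wr).
have [phi phiP] := choice ex1.
have ex2 (x : set_type limits) : exists r : ray G, tends (f \o sval r) (val x).
  exact: set_mem (valP x).
have [psi psiP] := choice ex2.
exists phi, (fun x => end_of (psi x)); split.
- move=> w; have [r wr] := end_ex w; apply: (end_eq (end_of_mem _) wr).
  by apply/close_map/(tends_unique_close (psiP _)); exact: (phiP _ _ wr).
- move=> x; apply: val_inj; apply: (tree_tends_unique hT _ (psiP x)).
  by apply: phiP; exact: end_of_mem.
- apply: continuous_comp_initial; apply: continuous_to_vend => D hD.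
  rewrite openE => w /= Dw; have [_ _ fD] := hD; have [r wr] := end_ex w.
  have /(vendC_tends fD (phiP _ _ wr))[M hM] := Dw.
  (* The vertex [c] below is so late on the ray that [f c] is in [D]. As [F] refines the boundary of
     [D], the map [f] sends the whole component of [c] into [D]. *)
  have [F fF hF] := f_cont fD; have [N hN] := ray_close r fF.
  pose c := sval r (N + M)%N.
  have rC := @region_comp G F c fF.
  have Cw : OmegaE (edge_comp F c) w.
    have [_ _ fC] := rC; apply/(OmegaE_ray fC wr); exists N => n Nn.
    by apply: hN => //; lia.
  apply: (filterS _ (open_nbhs_nbhs (conj (open_OmegaE rC) Cw))).
  move=> w' [s [ws Cs]]; apply/(vendC_tends fD (phiP _ _ ws)); exists 0%N => n _.
  by apply: joined_minus_boundary (hF _ _ (Cs n)) _; apply: hM; lia.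
- apply: continuous_to_edge_end => C rC; rewrite openE => x /= Cx.
  have [_ _ fC] := rC.
  have /(OmegaE_ray fC (end_of_mem _))[M hM] := Cx.
  (* Symmetrically, any vertex that [f] maps into the component of [c] in [T] minus [F'] belongs to
     [C]. *)
  have [F' fF' hF'] := f_open fC.
  have [N hN] : exists N, forall i j, (N <= i)%N -> (N <= j)%N ->
      joined (adj_minus F') (f (sval (psi x) i)) (f (sval (psi x) j)).
    by have /close_map h := ray_close (psi x); exact: h.
  pose c := f (sval (psi x) (N + M)%N).
  have rD := @region_comp T F' c fF'; have [_ _ fD] := rD.
  have Dx : vendC (edge_comp F' c) (val x).
    by apply/(vendC_tends fD (psiP x)); exists N => n Nn; apply: hN; lia.
  have nD : nbhs x ((val : set_type limits -> vend T) @^-1` vendC (edge_comp F' c)).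
    apply: initial_continuous; exact: (open_nbhs_nbhs (conj (open_vendC rD) Dx)).
  apply: filterS nD => y /= /(vendC_tends fD (psiP y))[K hK].
  apply/(OmegaE_ray fC (end_of_mem _)); exists K => n Kn.
  apply: (joined_minus_boundary (hF' (sval (psi x) (N + M)%N) _ (hK n Kn))).
  by apply: hM; lia.
Qed.
End Transfer.

(** * Attaching cliques to a tree *)

Section FibreCliques.
Variables (T : graph) (X : set (vend T)).

(* The vertices [(c, n)] over [c \in X] form an infinite clique, attached to the tree at
   [(c, 0)]; over [c \notin X] there is only [(c, 0)]. *)
Definition blowup_vtx := {p : vtx T * nat | X (inl p.1) \/ p.2 = 0%N}.

Definition blowup_adj (p q : blowup_vtx) :=
  ((sval p).1 = (sval q).1 /\ (sval p).2 <> (sval q).2) \/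
  [/\ adj (sval p).1 (sval q).1, (sval p).2 = 0%N & (sval q).2 = 0%N].

Lemma blowup_adj_sym p q : blowup_adj p q -> blowup_adj q p.
Proof.
move=> [[h1 h2]|[/adj_sym h1 h2 h3]]; [left|by right].
by split=> // h; apply: h2.
Qed.

Lemma blowup_adj_irrefl p : ~ blowup_adj p p.
Proof. by move=> [[]|[/adj_irrefl]]. Qed.

Definition blowup := Graph blowup_adj_sym blowup_adj_irrefl.

Definition blowup_proj (p : vtx blowup) : vtx T := (sval p).1.

Definition blowup_base (c : vtx T) : vtx blowup :=
  exist (fun p : vtx T * nat => X (inl p.1) \/ p.2 = 0%N) (c, 0%N) (or_intror erefl).

Lemma blowup_baseE p : (sval p).2 = 0%N -> p = blowup_base (blowup_proj p).
Proof. by case: p => -[c n] h /= n0; apply: sval_inj; rewrite /blowup_proj /= n0. Qed.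

(** Almost all vertices of the infinite clique avoid the endpoints of [F], and one of them gives a
    detour from [p] to its base. Its index [m] exceeds that of [p], so it differs from both. *)
Lemma blowup_joined_base (F : set (vtx blowup * vtx blowup)) p : finite_set F ->
  joined (adj_minus F) p (blowup_base (blowup_proj p)).
Proof.
move=> fF; have [p0|pn0] := eqVneq (sval p).2 0%N.
  by rewrite -(blowup_baseE p0); exact: joined_refl.
have Xp : X (inl (sval p).1) by case: (svalP p) => // p0; rewrite p0 eqxx in pn0.
pose r n : vtx blowup :=
  exist (fun p : vtx T * nat => X (inl p.1) \/ p.2 = 0%N) ((sval p).1, n) (or_introl Xp).
have rinj : injective r by move=> i j /(congr1 sval) [].
have [N hN] : exists N, forall w, ((fst @` F) `|` (snd @` F)) w -> forall n, (N <= n)%N -> r n <> w.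
  by apply: injective_leaves_finite => //; rewrite finite_setU; split; exact: finite_image.
pose m := (N + (sval p).2.+1)%N.
have mF q : ~ F (r m, q) /\ ~ F (q, r m).
  by split=> Fq; apply: (hN (r m) _ m); rewrite ?leq_addr//; [left|right]; eexists; eauto.
apply: (@joined_trans _ _ _ (r m)); apply: joined1.
- split; last by have [] := mF p.
  by left; split=> //=; rewrite /m; lia.
- split; last exact: mF.
  by left; split=> //=; rewrite /m; lia.
Qed.

Hypotheses (hT : is_tree T) (XT : @ends_in T `<=` X).

Definition blowup_proj_edges (F : set (vtx blowup * vtx blowup)) : set (vtx T * vtx T) :=
  (fun e => (blowup_proj e.1, blowup_proj e.2)) @` F.

Lemma blowup_lift (F : set (vtx blowup * vtx blowup)) u v : finite_set F ->
  joined (adj_minus (blowup_proj_edges F)) (blowup_proj u) (blowup_proj v) ->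
  joined (adj_minus F) u v.
Proof.
move=> fF uv; apply: joined_trans (blowup_joined_base u fF) _.
apply: joined_trans (joinedm_sym (blowup_joined_base v fF)).
move: uv; apply: (joined_ind
  (P := fun c => joined (adj_minus F) (blowup_base (blowup_proj u)) (blowup_base c))).
  exact: joined_refl.
move=> c d _ uc [cd [n1 n2]]; apply: joined_trans uc (joined1 _); split.
  by right.
by split=> Fcd; [apply: n1|apply: n2]; eexists; eauto.
Qed.

Lemma blowup_open (F : set (vtx blowup * vtx blowup)) : finite_set F ->
  exists2 F' : set (vtx T * vtx T), finite_set F' & forall u v,
    joined (adj_minus F') (blowup_proj u) (blowup_proj v) -> joined (adj_minus F) u v.
Proof.
move=> fF; exists (blowup_proj_edges F); first exact: finite_image.
by move=> u v; exact: blowup_lift.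
Qed.

Lemma blowup_cont (F' : set (vtx T * vtx T)) : finite_set F' ->
  exists2 F : set (vtx blowup * vtx blowup), finite_set F & forall u v,
    joined (adj_minus F) u v -> joined (adj_minus F') (blowup_proj u) (blowup_proj v).
Proof.
move=> fF; exists ((fun e => (blowup_base e.1, blowup_base e.2)) @` F'); first exact: finite_image.
move=> u v; apply: (joined_ind
  (P := fun w => joined (adj_minus F') (blowup_proj u) (blowup_proj w))).
  exact: joined_refl.
move=> a b _ ua [[[ab _]|[ab a0 b0]] [n1 n2]]; first by rewrite /blowup_proj -ab.
apply: joined_trans ua (joined1 _); split=> //.
by split=> Fab; [apply: n1|apply: n2]; eexists; eauto; rewrite -!blowup_baseE.
Qed.

Lemma blowup_connected : connected_graph blowup.
Proof.
have [[[c] Tc] _] := hT; split; first by constructor; exact: blowup_base c.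
move=> u v; apply: (@joined_sub _ (adj_minus set0)).
  by move=> a b [ab _]; exact: joined1.
apply: blowup_lift (finite_set0 _) _.
move: (Tc (blowup_proj u) (blowup_proj v)); apply: joined_sub => a b ab.
by apply: joined1; rewrite /blowup_proj_edges image_set0; split=> //; split.
Qed.

Lemma blowup_limits : limits blowup_proj = X.
Proof.
apply/seteqP; split => [[v|w]|[v|w]].
(* For [v] outside [X] the fibre is a single vertex, which the ray avoids from [N] on. The edge [vb]
   towards the tail then separates [v] from the tail. *)
- move=> [r vr]; apply: contrapT => nXv.
  have [N hN] : exists N, forall w, [set blowup_base v] w -> forall n, (N <= n)%N -> sval r n <> w.
    by apply: injective_leaves_finite; [case: (svalP r)|exact: finite_set1].
  have rv n : (N <= n)%N -> blowup_proj (sval r n) <> v.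
    move=> Nn rnv; apply: (hN _ erefl n Nn); rewrite -rnv; apply: blowup_baseE.
    by case: (svalP (sval r n)) => //; rewrite [(sval (sval r n)).1]rnv.
  have [b vb] := tree_separated hT (nesym (rv _ (leqnn N))); apply.
  have [M hM] := vr _ (finite_set1 (v, b)).
  apply: joined_trans (hM M (M + N)%N (leqnn _) (leq_addr _ _)) _; apply: joinedm_sym.
  (* An edge of the ray inside a clique projects to a single vertex, so each step is itself a walk
     and [joined] is nested. *)
  have tl i j : (N <= i)%N -> (i <= j)%N ->
      joined (joined (adj_minus [set (v, b)])) (blowup_proj (sval r i)) (blowup_proj (sval r j)).
    apply: (joined_tail (r := fun n => blowup_proj (sval r n)) (N := N)) => n Nn.
    have [_ radj] := svalP r; have [[h _]|[h _ _]] := radj n.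
      by rewrite /blowup_proj h; exact: joined_refl.
    apply: joined1; split=> //; split=> -[] h1 h2; first exact: (rv n Nn).
    by apply: (rv n.+1); first lia.
  by apply: joined_sub (tl N (M + N)%N _ _) => //; rewrite leq_addl.
- by move=> _; apply: XT; exists w.
(* The clique over [v] contains a ray whose projection is constantly [v]. *)
- move=> Xv.
  pose r n : vtx blowup :=
    exist (fun p : vtx T * nat => X (inl p.1) \/ p.2 = 0%N) (v, n) (or_introl Xv).
  have rr : is_ray r.
    split; first by move=> i j /(congr1 sval) [].
    by move=> n; left; split=> //=; lia.
  exists (exist _ r rr) => F fF; exists 0%N => i j _ _; exact: joined_refl.
- move=> _; apply: (ends_in_limits blowup_connected hT _ blowup_cont blowup_open); last by exists w.
  by move=> c; exists (blowup_base c).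
Qed.

Lemma blowup_homeomorphic : homeomorphic (edge_end blowup) (set_type X).
Proof.
rewrite -blowup_limits.
exact: (limits_homeomorphic hT blowup_cont blowup_open).
Qed.
End FibreCliques.

(** * Partitioning a region *)

Section Inseparable.
Variable G : graph.
Implicit Types (x y u v : vtx G) (A B C : set (vtx G)) (F : set (vtx G * vtx G)).

Definition insep x v := forall F, finite_set F -> joined (adj_minus F) x v.

Lemma insep_refl x : insep x x.
Proof. by move=> F _; exact: joined_refl. Qed.

Lemma insep_mem A x v : finite_set (boundary A) -> insep x v -> A x <-> A v.
Proof.
move=> fA xv; have j := xv _ fA; split; first exact: joined_minus_boundary.
exact: joined_minus_boundary (joinedm_sym j).
Qed.

Lemma finite_boundaryU A B : finite_set (boundary A) -> finite_set (boundary B) ->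
  finite_set (boundary (A `|` B)).
Proof.
move=> fA fB; apply: (@sub_finite_set _ _ (boundary A `|` boundary B)); last by rewrite finite_setU.
by move=> [a b] [/= [Aa|Ba] /not_orP[nA nB] ab]; [left|right].
Qed.

Definition cut_from x y A := [/\ A y, ~ A x, finite_set (boundary A) &
  forall u, A u -> joined (inside A) y u].

Lemma cut_from_ex x v : ~ insep x v -> exists A, cut_from x v A.
Proof.
move=> /existsNP[F /not_implyP[fF nj]]; exists (edge_comp F v); split.
- exact: joined_refl.
- by move=> /joinedm_sym.
- exact: finite_boundary_comp.
- by move=> u; exact: joined_inside_comp.
Qed.

Lemma cut_from_union x y v A B : cut_from x y A -> cut_from x v B ->
  (A v \/ exists2 u, A u & adj u v) -> cut_from x y (A `|` B).
Proof.
move=> [Ay nAx fA jA] [Bv nBx fB jB] Av; split.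
- by left.
- by move=> [].
- exact: finite_boundaryU.
- have jA' u : A u -> joined (inside (A `|` B)) y u.
    by move=> /jA; apply: joined_inside_subset => w; left.
  have yv : joined (inside (A `|` B)) y v.
    case: Av => [/jA'//|[u Au uv]]; apply: joined_trans (jA' u Au) (joined1 _).
    by split=> //; [left|right].
  move=> u [/jA'//|/jB vu]; apply: joined_trans yv _.
  by apply: joined_inside_subset vu => w; right.
Qed.

(** Each vertex of the path has its own finite cut. The path is finite, so the union is again a
    finite cut, connected because consecutive cuts touch. *)
Lemma cut_from_path x y v : ~ insep x y ->
  joined (inside [set u | ~ insep x u]) y v -> exists2 A, cut_from x y A & A v.
Proof.
move=> /cut_from_ex[A0 cA0].
apply: (joined_ind (P := fun v => exists2 A, cut_from x y A & A v)).
  by exists A0 => //; case: cA0.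
move=> u w _ [A cA Au] [_ nw uw]; have [B cB] := cut_from_ex nw.
exists (A `|` B); last by right; case: cB.
by apply: cut_from_union cA cB _; right; exists u.
Qed.

(* The sets [M k] are the components of [y] in [G - E], where [E] is obtained
   by repeatedly choosing a [y]-[x] path avoiding the edges deleted so far and deleting one
   of its finitely many edges. A connected cut [A] steers these choices: each path contains
   an edge of [boundary A], so after at most [|boundary A|] steps [y] and [x] are separated. *)
Lemma countable_cut_exhaustion x y : exists M : nat -> set (vtx G),
  (forall k, [/\ ~ M k x, finite_set (boundary (M k)) &
     forall u, M k u -> joined (inside (M k)) y u]) /\
  (forall A, cut_from x y A -> exists k, A `<=` M k).
Proof.
pose sepE (E : seq (vtx G * vtx G)) := joined (adj_minus [set` E]) y x.
have pth_ex (E : seq (vtx G * vtx G)) : exists s : seq (vtx G * vtx G), sepE E ->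
    forall A, A y -> ~ A x -> exists e, [/\ e \in s, boundary A e & e \notin E].
  have [[n [p [p0 pn pe]]]|nE] := pselect (sepE E); last by exists [::].
  exists [seq (p i, p i.+1) | i <- iota 0 n] => _ A Ay nAx.
  have j : joined (fun u v => adj_minus [set` E] u v /\
      (u, v) \in [seq (p i, p i.+1) | i <- iota 0 n]) y x.
    exists n, p; split=> // i il; split; first exact: pe.
    by apply/mapP; exists i; rewrite ?mem_iota.
  have [a [b [_ Aa nAb [[ab [/negP nE _]] abs]]]] := joined_exit j Ay nAx.
  by exists (a, b).
have [pth pthP] := choice pth_ex.
(* A list of indices encodes the choices made, and [dec] turns it into the list of deleted edges.
   There are countably many such lists, so the sets [D c] can be enumerated. *)
pose dec := fix dec (c : seq nat) : seq (vtx G * vtx G) :=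
  if c is i :: c' then nth (y, x) (pth (dec c')) i :: dec c' else [::].
pose D c : set (vtx G) := [set u | ~ sepE (dec c) /\ edge_comp [set` dec c] y u].
have DP c : [/\ ~ D c x, finite_set (boundary (D c)) &
    forall u, D c u -> joined (inside (D c)) y u].
  have [j|nj] := pselect (sepE (dec c)).
    have -> : D c = set0 by rewrite -subset0 => u [].
    split=> //; apply: sub_finite_set (finite_set0 (vtx G * vtx G)).
    by move=> [a b] [].
  have -> : D c = edge_comp [set` dec c] y.
    by apply/seteqP; split=> [u []|u uu].
  split=> //; last by move=> u; exact: joined_inside_comp.
  by apply: finite_boundary_comp; apply/finite_seqP; exists (dec c).
exists (fun k => if choice.unpickle k is Some c then D c else set0); split.
  move=> k; case: choice.unpickle => [c|]; first exact: DP.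
  split=> //.
  by apply: sub_finite_set (finite_set0 (vtx G * vtx G)); move=> [a b] [].
move=> A [Ay nAx fA jA].
suff [c [cA nc]] : exists c, (forall e, e \in dec c -> boundary A e) /\ ~ sepE (dec c).
  exists (choice.pickle c); rewrite choice.pickleK => u /jA yu; split=> //.
  apply: joined_inside_minus yu => a b Aa Ab /cA [].
  by move=> _ /(_ Ab).
apply: contrapT => nex.
have /finite_seqP[s sE] := fA.
have [c [cu csz cA]] : exists c, [/\ uniq (dec c), size (dec c) = (size s).+1 &
    forall e, e \in dec c -> boundary A e].
  elim: (size s).+1 => [|n [c [cu csz cA]]]; first by exists [::].
  have j : sepE (dec c) by apply: contrapT => nj; apply: nex; exists c.
  have [e [es eA eE]] := pthP _ j A Ay nAx.
  exists (index e (pth (dec c)) :: c); rewrite /= nth_index// eE cu csz; split=> // e'.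
  by rewrite inE => /orP[/eqP ->|/cA].
have := uniq_leq_size cu (s2 := s); rewrite csz ltnn => h.
suff : false by []; apply: h => e /cA; by rewrite sE.
Qed.

Hypothesis Gc : connected_graph G.

(* A component of [G] minus the vertices inseparable from [x] is exhausted by countably
   many finite cuts [M 0, M 1, ...]; the pieces are the differences of [M k] and the
   union of the [M j], [j < k]. *)
Lemma insep_complement_partition x : exists P : vtx G -> set (vtx G),
  [/\ forall v, ~ insep x v -> P v v,
      forall v, ~ insep x v -> finite_set (boundary (P v)),
      forall u v, ~ insep x v -> P v u -> ~ insep x u /\ P u = P v &
      forall A, finite_set (boundary A) -> ~ A x -> finite_set [set P v | v in A]].
Proof.
pose N : set (vtx G) := [set u | ~ insep x u].
pose S v := comp_in N v.
(* All vertices of a component share this representative, hence also the sequence of cuts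
   [M (rep v)]. *)
pose rep v := xget x (S v).
have repS v : S v (rep v) by apply: (@xgetPex _ x (S v)); exists v; exact: joined_refl.
have [M MP] := choice (countable_cut_exhaustion x).
have MN y k : M y k `<=` N.
  move=> u Mu xu; have [/(_ k)[nMx fM _] _] := MP y.
  by apply: nMx; apply/(insep_mem fM xu).
have Nrep v : N v -> N (rep v) by move=> Nv; exact: comp_in_subset Nv _ (repS v).
have repE u v : S u = S v -> rep u = rep v by rewrite /rep => ->.
have coverB v B : N v -> cut_from x v B -> exists k, B `<=` M (rep v) k.
  move=> Nv cB.
  have [A cA Av] := cut_from_path (Nrep _ Nv) (joined_inside_sym (repS v)).
  have [_ /(_ _ (cut_from_union cA cB (or_introl Av)))[k hk]] := MP (rep v).
  by exists k => u Bu; apply: hk; right.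
have ix_ex v : exists k, N v -> M (rep v) k v /\ forall j, M (rep v) j v -> (k <= j)%N.
  have [Nv|nNv] := pselect (N v); last by exists 0%N.
  have [A cA] := cut_from_ex Nv.
  have ex : exists k, `[< M (rep v) k v >].
    have [k hk] := coverB v A Nv cA; exists k; apply/asboolP/hk.
    by case: cA.
  case: (ex_minnP ex) => k /asboolP Mk kmin; exists k => _; split=> // j Mj.
  by apply: kmin; apply/asboolP.
have [ix ixP] := choice ix_ex.
pose P v : set (vtx G) := [set u | [/\ N u, S u = S v & ix u = ix v]].
have PE v : N v -> P v = [set u | M (rep v) (ix v) u /\
    forall j, (j < ix v)%N -> ~ M (rep v) j u].
  move=> Nv; apply/seteqP; split => u.
  - move=> [Nu /repE uv iuv]; have [M1 M2] := ixP u Nu.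
    rewrite uv iuv in M1 M2; split=> // j jlt /M2.
    by rewrite leqNgt jlt.
  - move=> [Mu nMu]; have Nu := MN _ _ _ Mu.
    have Suv : S u = S v.
      have [/(_ (ix v))[_ _ jM] _] := MP (rep v).
      have vu : S (rep v) u by apply: joined_inside_subset (jM _ Mu); exact: MN.
      by rewrite /S (comp_in_eq vu) (comp_in_eq (repS v)).
    split=> //; have [M1 M2] := ixP u Nu; rewrite (repE _ _ Suv) in M1 M2.
    by apply/eqP; rewrite eqn_leq M2//= leqNgt; apply/negP => /nMu.
exists P; split.
- by move=> v Nv; split.
- move=> v Nv; rewrite PE//.
  have fM k : finite_set (boundary (M (rep v) k)) by have [/(_ k)[]] := MP (rep v).
  (* Induction on the bound for [j] alone: each step intersects with the complement of one more
     cut. *)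
  elim: {2}(ix v) => [|n IH].
    apply: sub_finite_set (fM (ix v)) => -[a b] [/= [Ma _] nMb ab].
    by split=> // Mb; apply: nMb.
  have := finite_boundaryI IH (finite_boundaryC (fM n)).
  congr (finite_set (boundary _)); apply/seteqP; split=> u.
  + move=> [[Mu nMu] nMn]; split=> // j; rewrite ltnS leq_eqVlt => /orP[/eqP ->//|].
    exact: nMu.
  + move=> [Mu nMu]; split; last exact: nMu.
    by split=> // j jn; apply: nMu; exact: ltnW.
- move=> u v _ [Nu Suv iuv]; split=> //.
  by rewrite /P Suv iuv.
- move=> A fA nAx.
  have AN : A `<=` N by move=> u Au xu; apply: nAx; apply/(insep_mem fA xu).
  (* [A] has finitely many components. Each is a finite cut from [x], hence contained in a single
     [M k], and so meets only pieces of index at most [k]. *)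
  apply: (@sub_finite_set _ _ (\bigcup_(B in [set comp_in A v | v in A]) [set P u | u in B])).
    by move=> _ [v Av <-]; exists (comp_in A v); [exists v|exists v => //; exact: joined_refl].
  apply: bigcup_finite; first exact: finite_comp_in.
  move=> _ [v Av <-]; have Nv := AN _ Av.
  have [_ _ fB] := region_comp_in Av fA.
  have [|k hk] := coverB v (comp_in A v) Nv.
    split=> //; [exact: joined_refl|by move=> /(comp_in_subset Av)|].
    by move=> u; exact: joined_inside_comp_in.
  apply: (@sub_finite_set _ _ ((fun j => [set w | [/\ N w, S w = S v & ix w = j]]) @` `I_k.+1)).
    move=> _ [u Bu <-]; have Nu := AN _ (comp_in_subset Av Bu).
    have Suv : S u = S v by apply: comp_in_eq; exact: joined_inside_subset Bu.
    exists (ix u); last by rewrite /P Suv.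
    have [_ M2] := ixP u Nu; rewrite /= ltnS; apply: M2.
    by rewrite (repE _ _ Suv); exact: hk.
  exact/finite_image/finite_II.
Qed.

(** A piece [P v] may reach outside [C] or be disconnected, so the children are the components of
    [C] intersected with the pieces. Each piece contributes finitely many by [finite_comp_in]. *)
Lemma region_children C x : finite_set (boundary C) -> exists Q : vtx G -> set (vtx G),
  [/\ forall v, C v -> ~ insep x v -> [/\ Q v v, is_region (Q v), Q v `<=` C &
        forall u, Q v u -> ~ insep x u /\ Q u = Q v] &
      forall A, finite_set (boundary A) -> ~ A x -> finite_set [set Q v | v in A `&` C]].
Proof.
move=> fC; have [P [Pv Pf PE PA]] := insep_complement_partition x.
exists (fun v => comp_in (C `&` P v) v); split.
- move=> v Cv nv; have CPv : (C `&` P v) v by split=> //; exact: Pv.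
  split.
  + exact: joined_refl.
  + by apply: region_comp_in => //; apply: finite_boundaryI => //; exact: Pf.
  + by move=> u /(comp_in_subset CPv)[].
  + move=> u vu; have [_ Pu] := comp_in_subset CPv vu; have [nu Puv] := PE _ _ nv Pu.
    by rewrite Puv (comp_in_eq vu).
- move=> A fA nAx.
  have AN u : A u -> ~ insep x u by move=> Au xu; apply: nAx; apply/(insep_mem fA xu).
  apply: (@sub_finite_set _ _ (\bigcup_(R in [set P v | v in A])
      [set comp_in (C `&` R) w | w in C `&` R])).
    move=> _ [v [Av Cv] <-]; exists (P v); first by exists v.
    by exists v => //; split=> //; exact/Pv/AN.
  apply: bigcup_finite; first exact: PA.
  move=> _ [v Av <-]; apply: finite_comp_in => //; apply: finite_boundaryI => //.
  exact/Pf/AN.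
Qed.
End Inseparable.

(** * The tree of regions *)

Section RootedTree.
Variables (N : Type) (root : N) (par : N -> N) (lev : N -> nat).
Hypothesis lev0 : forall c, lev c = 0%N -> c = root.
Hypothesis lev_par : forall c, (0 < lev c)%N -> (lev (par c)).+1 = lev c.

Definition parent_adj (c e : N) := ((0 < lev c)%N /\ e = par c) \/ ((0 < lev e)%N /\ c = par e).

Lemma parent_adj_sym c e : parent_adj c e -> parent_adj e c.
Proof. by move=> []; [right|left]. Qed.

Lemma parent_adj_irrefl c : ~ parent_adj c c.
Proof. by move=> [] [/lev_par + cc]; rewrite -cc => /esym/n_Sn. Qed.

Definition rooted_graph := Graph parent_adj_sym parent_adj_irrefl.

(** Climbing along [par] reaches the root. On a cycle, both neighbours of a vertex of maximal level
    would be its parent. *)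
Lemma rooted_graph_tree : is_tree rooted_graph.
Proof.
split.
- split; first by constructor; exact: root.
  have jr : forall c : vtx rooted_graph, joined (@adj rooted_graph) c root.
    move=> c; move: {2}(lev c) (erefl (lev c)) => n; elim: n c => [|n IH] c cn.
      by rewrite (lev0 cn); exact: joined_refl.
    have c0 : (0 < lev c)%N by rewrite cn.
    apply: (@joined_trans _ _ _ (par c)); first by apply: joined1; left.
    by apply: IH; have := lev_par c0; rewrite cn => -[].
  by move=> x y; apply: joined_trans (jr x) (joined_sym (@parent_adj_sym) (jr y)).
- move=> [n [f [n3 finj fadj flast]]].
  have [i ilt imax] : exists2 i, (i < n)%N & forall j, (j < n)%N -> (lev (f j) <= lev (f i))%N.
    have n0 : (0 < n)%N by lia.
    pose i := [arg max_(i > Ordinal n0 | true) lev (f i)]%N.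
    exists i; first exact: ltn_ord.
    rewrite /i; case: arg_maxnP => // k _ kmax j jn.
    exact: (kmax (Ordinal jn) isT).
  have up j : (j < n)%N -> @adj rooted_graph (f i) (f j) -> f j = par (f i).
    move=> jn [[_ ->//]|[lj fi]]; have := lev_par lj; have := imax j jn; rewrite fi; lia.
  have clash j k : (j < n)%N -> (k < n)%N -> @adj rooted_graph (f i) (f j) ->
      @adj rooted_graph (f i) (f k) -> j = k.
    by move=> jn kn aj ak; apply: finj => //; rewrite (up j)// (up k).
  have prev k : (k.+1 < n)%N -> @adj rooted_graph (f k.+1) (f k).
    by move=> kn; apply: adj_sym; exact: fadj.
  have [i0|i0] := posnP i.
    suff : (1 = n.-1)%N by lia.
    apply: clash; [lia|lia| |].
    + by rewrite i0; apply: fadj; lia.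
    + by rewrite i0; apply: adj_sym.
  have [il|il] := eqVneq i n.-1.
    suff : (0 = i.-1)%N by lia.
    apply: clash; [lia|lia| |]; first by rewrite il.
    by rewrite -{1}(prednK i0); apply: prev; lia.
  suff : (i.-1 = i.+1)%N by lia.
  apply: clash; [lia|lia| |].
  + by rewrite -{1}(prednK i0); apply: prev; lia.
  + by apply: fadj; lia.
Qed.
End RootedTree.

(** [d] is the distance from [v0], and [u] precedes [v] on a shortest path. *)
Lemma connected_descent (G : graph) (v0 : vtx G) : connected_graph G ->
  exists d : vtx G -> nat, forall v, v <> v0 -> exists2 u, adj v u & (d u < d v)%N.
Proof.
move=> [_ Gc].
pose P v n := `[< exists p : nat -> vtx G,
  [/\ p 0%N = v0, p n = v & forall i, (i < n)%N -> adj (p i) (p i.+1)] >].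
have exP v : exists n, P v n by have [n [p h]] := Gc v0 v; exists n; apply/asboolP; exists p.
exists (fun v => ex_minn (exP v)) => v vv0.
case: ex_minnP => n /asboolP[p [p0 pn pe]] nmin.
case: n pn pe nmin => [pn|n pn pe nmin]; first by case: vv0; rewrite -pn -p0.
exists (p n); first by apply: adj_sym; rewrite -pn; exact: pe.
case: ex_minnP => m _ mmin; rewrite ltnS; apply: mmin; apply/asboolP; exists p; split=> // i ilt.
by apply: pe; exact: ltnW.
Qed.

(** * Iterated partition: the regions as nodes of a tree *)

Section RegionTree.
Variables (G : graph) (v0 : vtx G) (d : vtx G -> nat).
Hypothesis Gc : connected_graph G.
Hypothesis d_desc : forall v, v <> v0 -> exists2 u, adj v u & (d u < d v)%N.
Variable top : set (vtx G) -> vtx G.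
Hypothesis top_min : forall C u, C u -> C (top C) /\ (d (top C) <= d u)%N.
Variable Q : set (vtx G) -> vtx G -> set (vtx G).
Hypothesis QP : forall C v, finite_set (boundary C) -> C v -> ~ insep (top C) v ->
  [/\ Q C v v, is_region (Q C v), Q C v `<=` C &
      forall u, Q C v u -> ~ insep (top C) u /\ Q C u = Q C v].
Hypothesis Q_fin : forall C A, finite_set (boundary C) -> finite_set (boundary A) ->
  ~ A (top C) -> finite_set [set Q C v | v in A `&` C].
Implicit Types (u v w : vtx G) (C : set (vtx G)).

(* [R n v] is the region of level [n] containing [v]; it is empty when [v] has
   been absorbed at a smaller level. *)
Fixpoint R n v : set (vtx G) := if n is m.+1 then
  [set u | [/\ R m v v, ~ insep (top (R m v)) v & Q (R m v) v u]] else setT.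

Lemma R_E n v : R n v v -> ~ insep (top (R n v)) v -> R n.+1 v = Q (R n v) v.
Proof. by move=> h1 h2; apply/seteqP; split => [u []|u]. Qed.

Lemma R_finite n v : finite_set (boundary (R n v)).
Proof.
elim: n => [|n IH] /=; first by rewrite boundary_setT.
have [[h1 h2]|h] := pselect (R n v v /\ ~ insep (top (R n v)) v).
  by have /= -> := R_E h1 h2; have [_ []] := QP IH h1 h2.
apply: sub_finite_set (finite_set0 (vtx G * vtx G)).
by move=> [a b] [/= [h1 h2]]; case: h.
Qed.

Lemma R_self n v u : R n v u -> R n v v.
Proof.
by case: n => //= n [h1 h2 _]; split=> //; have [] := QP (R_finite n v) h1 h2.
Qed.

Lemma R_S n v : R n.+1 v `<=` R n v.
Proof. by move=> u [h1 h2]; have [_ _ + _] := QP (R_finite n v) h1 h2; apply. Qed.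

Lemma R_anti v n m : (n <= m)%N -> R m v `<=` R n v.
Proof. by move: n m; apply: (decreasing_subset (C := R ^~ v)) => n; exact: R_S. Qed.

(** By induction the regions one level up agree, and [Q] takes the same value throughout a child.
    Hence regions of one level are equal or disjoint. *)
Lemma R_eq n v u : R n v u -> R n u = R n v.
Proof.
elim: n => //= n IH [h1 h2 hu].
have [_ _ sub hQ] := QP (R_finite n v) h1 h2.
have [nu Quv] := hQ u hu; rewrite (IH (sub _ hu)) Quv.
by apply/seteqP; split => w [_ _ Qw]; split=> //; exact: sub.
Qed.

Lemma R_top n v u : R n.+1 v u -> ~ insep (top (R n v)) u.
Proof. by move=> [h1 h2 hu]; have [_ _ _ /(_ u hu)[]] := QP (R_finite n v) h1 h2. Qed.

Lemma R_not_absorbed n m v : (n < m)%N -> R m v v -> ~ insep (top (R n v)) v.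
Proof. by move=> nm Rm; apply: R_top; exact: R_anti nm _ Rm. Qed.

Lemma R_region n v : R n v v -> is_region (R n v).
Proof.
case: n => [_|n Rv]; last first.
  by have [h1 h2 _] := Rv; rewrite R_E//; have [] := QP (R_finite n v) h1 h2.
split; [by exists v| |exact: (R_finite 0 v)].
have [_ jG] := Gc; move=> x y _ _; apply: joined_sub (jG x y) => a b ab.
by apply: joined1.
Qed.

(* Once all vertices of [R n v] are at [d]-distance at least [k], those at distance [k]
   are [v0] or endpoints of boundary edges, hence finitely many, and each further step
   removes one of them. *)
Lemma R_far v : (forall n, R n v v) -> forall k, exists n, forall u, R n v u -> (k <= d u)%N.
Proof.
move=> Rv; elim=> [|k [n hn]]; first by exists 0%N.
suff H : forall N L m, (size L <= N)%N -> (n <= m)%N ->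
    (forall u, R m v u -> d u = k -> u \in L) ->
    exists m', forall u, R m' v u -> (k < d u)%N.
  have /finite_seqP[s sE] := finite_image fst (R_finite n v).
  apply: (H _ (v0 :: s) n (leqnn _) (leqnn _)) => u Ru uk; rewrite inE.
  have [//|/eqP/d_desc[u' uu' u'u]] := eqVneq u v0.
  suff : [set` s] u by [].
  rewrite -sE; exists (u, u') => //; split=> //= /hn; rewrite -uk; lia.
elim=> [|N IH] L m sz nm hL.
  exists m => u Ru; have := hn _ (R_anti nm Ru); rewrite leq_eqVlt => /orP[/eqP uk|//].
  by have := hL u Ru (esym uk); case: L sz {hL}.
have [[u [Ru uk]]|none] := pselect (exists u, R m v u /\ d u = k); last first.
  exists m => u Ru; have := hn _ (R_anti nm Ru); rewrite leq_eqVlt => /orP[/eqP uk|//].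
  by case: none; exists u.
have [Rt tu] := top_min Ru; set t := top (R m v) in Rt tu.
have tk : d t = k by apply/eqP; rewrite eqn_leq -{1}uk tu (hn _ (R_anti nm Rt)).
have tL := hL _ Rt tk.
apply: (IH (seq.filter (predC (pred1 t)) L) m.+1).
- have : (0 < count (pred1 t) L)%N by rewrite -has_count has_pred1.
  by rewrite size_filter; have := count_predC (pred1 t) L; lia.
- exact: leqW.
- move=> w Rw wk; rewrite mem_filter (hL w (R_S Rw) wk) andbT /=.
  by apply/eqP => wt; apply: (R_top Rw); rewrite wt; exact: insep_refl.
Qed.

(** Otherwise [v] would lie in a region of every level, but by [R_far] these eventually contain only
    vertices with larger [d] than [v]. *)
Lemma R_absorb v : exists n, R n v v /\ insep (top (R n v)) v.
Proof.
apply: contrapT => nex.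
have Rv n : R n v v.
  elim: n => [//|n IH]; have nt : ~ insep (top (R n v)) v by move=> h; apply: nex; exists n.
  by rewrite R_E//; have [] := QP (R_finite n v) IH nt.
by have [n /(_ v (Rv n))] := R_far Rv (d v).+1; rewrite ltnn.
Qed.

(** Nodes are bare sets, so that all vertices of a region name the same node; [node_level] recovers
    a level. *)
Definition is_node C := exists n v, R n v v /\ C = R n v.
Definition node := {C | is_node C}.
Definition mknode n v (h : R n v v) : node :=
  exist is_node (R n v) (ex_intro _ n (ex_intro _ v (conj h erefl))).

Lemma node_level (c : node) : exists n,
  R n (top (sval c)) = sval c /\ R n (top (sval c)) (top (sval c)).
Proof.
case: c => C [n [v [h CE]]] /=; exists n; rewrite {}CE.
have [ht _] := top_min h; rewrite (R_eq ht); split=> //.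
Qed.

Definition lev (c : node) : nat := sval (cid (node_level c)).
Definition apex (c : node) : vtx G := top (sval c).

Lemma R_lev c : R (lev c) (apex c) = sval c.
Proof. by rewrite /lev; case: cid => n []. Qed.

Lemma R_apex c : R (lev c) (apex c) (apex c).
Proof. by rewrite /lev /apex; case: cid => n []. Qed.

(** The level of a region is unique: its top, being inseparable from itself, lies in no region of a
    later level. *)
Lemma lev_mknode n v (h : R n v v) : lev (mknode h) = n.
Proof.
set c := mknode h; have Rc := R_lev c; have Ra := R_apex c.
have hn : R n (apex c) = sval c by apply: R_eq; rewrite -[R n v]/(sval c) -Rc.
case: (ltngtP (lev c) n) => // lt; exfalso.
- apply: (R_not_absorbed lt (v := apex c)); first by rewrite hn -Rc.
  by rewrite Rc; exact: insep_refl.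
- by apply: (R_not_absorbed lt Ra); rewrite hn; exact: insep_refl.
Qed.

Lemma par_subproof c : R (lev c).-1 (apex c) (apex c).
Proof. exact: R_anti (leq_pred _) _ (R_apex c). Qed.

Definition par c : node := mknode (par_subproof c).
Definition root : node := @mknode 0 v0 I.

Lemma lev_par c : (0 < lev c)%N -> (lev (par c)).+1 = lev c.
Proof. by move=> c0; rewrite lev_mknode prednK. Qed.

Lemma lev_root c : lev c = 0%N -> c = root.
Proof. by move=> c0; apply: sval_inj; rewrite -R_lev c0. Qed.

Lemma mknode_eq n u v (hu : R n u u) (hv : R n v v) : R n v u -> mknode hu = mknode hv.
Proof. by move=> vu; apply: sval_inj; exact: R_eq vu. Qed.

Lemma par_mknode n v (h : R n v v) (h' : R n.+1 v v) : par (mknode h') = mknode h.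
Proof.
apply: sval_inj => /=; rewrite lev_mknode /=; apply/R_eq/R_S.
by have [] := top_min h'.
Qed.

Definition region_tree := rooted_graph lev_par.

Lemma region_tree_is_tree : is_tree region_tree.
Proof. exact: (rooted_graph_tree lev_root). Qed.

Definition absorb_level v := sval (cid (R_absorb v)).

Lemma absorb_self v : R (absorb_level v) v v.
Proof. by rewrite /absorb_level; case: cid => n []. Qed.

Definition absorb v : vtx region_tree := mknode (absorb_self v).

Lemma absorb_insep v : insep (apex (absorb v)) v.
Proof. by rewrite /apex /= /absorb_level; case: cid => n []. Qed.

Lemma absorb_max n v : R n v v -> (n <= absorb_level v)%N.
Proof. by move=> Rn; rewrite leqNgt; apply/negP => /R_not_absorbed/(_ Rn)/(_ (absorb_insep v)). Qed.

(** An apex is inseparable from itself, so it is discarded in its own node. This makes [absorb]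
    surjective. *)
Lemma absorb_apex (c : node) : absorb (apex c) = c.
Proof.
apply: sval_inj; rewrite -[RHS]R_lev /=; congr (R _ _); apply/eqP.
rewrite eqn_leq (absorb_max (R_apex c)) andbT leqNgt; apply/negP => lt.
apply: (R_not_absorbed lt (absorb_self _)); rewrite R_lev; exact: insep_refl.
Qed.

(* If [u] and [w] are adjacent, every edge of the tree path between their nodes has a lower
   node containing exactly one of [u], [w], so [uw] lies in the boundary of that node. *)
Lemma absorb_cont (F' : set (vtx region_tree * vtx region_tree)) : finite_set F' ->
  exists2 F : set (vtx G * vtx G), finite_set F & forall u v,
    joined (adj_minus F) u v -> joined (adj_minus F') (absorb u) (absorb v).
Proof.
move=> fF'.
pose F := \bigcup_(e in F') (boundary (sval e.1) `|` boundary (sval e.2)).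
have fnode (c : node) : finite_set (boundary (sval c)) by rewrite -R_lev; exact: R_finite.
exists F; first by apply: bigcup_finite => // e _; rewrite finite_setU; split; exact: fnode.
have descend u w m (h : R m u u) : adj_minus F u w -> ~ R m.+1 u w ->
    joined (adj_minus F') (mknode h : vtx region_tree) (absorb u).
  move=> [uw [nF _]] nw.
  have H k : (m <= k)%N -> forall hk : R k u u,
      joined (adj_minus F') (mknode h : vtx region_tree) (mknode hk).
    move=> /subnKC <-; elim: (k - m)%N => [|j IH].
      by rewrite addn0 => hk; rewrite (Prop_irrelevance hk h); exact: joined_refl.
    rewrite addnS => hk; have hk' : R (m + j)%N u u by exact: R_S.
    apply: joined_trans (IH hk') (joined1 _).
    have nwk : ~ R (m + j).+1 u w by apply: contra_not nw; apply: R_anti; rewrite ltnS leq_addr.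
    split; first by right; rewrite lev_mknode (par_mknode hk').
    by split=> Fe; apply: nF; eexists; eauto; [right|left].
  by apply: H; exact: absorb_max.
move=> u v; apply: (joined_ind (P := fun w => joined (adj_minus F') (absorb u) (absorb w))).
  exact: joined_refl.
move=> a b _ ua ab; apply: joined_trans ua _.
(* [m] is the last level at which [a] and [b] share a region; the tree walk climbs from [absorb a]
   to that region and descends to [absorb b]. *)
have ex : exists m, `[< R m a b >] by exists 0%N; apply/asboolP.
have ub m : `[< R m a b >] -> (m <= absorb_level a)%N by move=> /asboolP/R_self/absorb_max.
case: (ex_maxnP ex ub) => m /asboolP Rab mmax.
have nRab : ~ R m.+1 a b by move=> /asboolP/mmax; rewrite ltnn.
have nRba : ~ R m.+1 b a by move=> ba; apply: nRab; rewrite (R_eq ba); exact: R_self ba.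
have ha := R_self Rab; have hb : R m b b by rewrite (R_eq Rab).
apply: joined_trans (joinedm_sym (descend a b m ha ab nRab)) _.
rewrite -(mknode_eq hb ha Rab).
by apply: (descend b a m hb) => //; exact: adj_minus_sym.
Qed.

(* If [F] separates the apices of [C] and of its child [D], then [C] contains an endpoint
   [w] of [F], which leaves finitely many choices of [C] since [w] is absorbed, and [D]
   meets the finite cut formed by the vertices that [F] separates from the apex of [C]. *)
Lemma absorb_open (F : set (vtx G * vtx G)) : finite_set F ->
  exists2 F' : set (vtx region_tree * vtx region_tree), finite_set F' & forall u v,
    joined (adj_minus F') (absorb u) (absorb v) -> joined (adj_minus F) u v.
Proof.
move=> fF.
pose bad := [set e : node | (0 < lev e)%N /\ ~ joined (adj_minus F) (apex (par e)) (apex e)].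
(* [bad] records, by their lower nodes, the tree edges whose apices are separated by [F]. *)
have fbad : finite_set bad.
  pose W := (fst @` F) `|` (snd @` F).
  pose A w k := ~` edge_comp F (top (R k w)).
  pose B := \bigcup_(w in W) \bigcup_(k in `I_(absorb_level w).+1)
    [set Q (R k w) v | v in A w k `&` R k w].
  have fB : finite_set B.
    apply: bigcup_finite => [|w _]; first by rewrite finite_setU; split; exact: finite_image.
    apply: bigcup_finite => [|k _]; first exact: finite_II.
    apply: Q_fin; first exact: R_finite.
      by apply: finite_boundaryC; exact: finite_boundary_comp.
    by apply; exact: joined_refl.
  apply: (@sub_finite_set _ _ ((fun c : node => sval c) @^-1` B)); last first.
    by apply: finite_preimage fB => c e _ _; exact: sval_inj.
  move=> e [e0 ne] /=; set t := apex e in ne *; pose n := (lev e).-1.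
  have Rt : R n.+1 t t by rewrite /n prednK//; exact: R_apex.
  have parE : sval (par e) = R n t by [].
  (* Otherwise the region, being connected, would join the two apices without using [F]. *)
  have [w Ww Rw] : exists2 w, W w & R n t w.
    apply: contrapT => now; apply: ne.
    have [_ jC _] := R_region (R_S Rt).
    apply: (@joined_inside_minus _ F (R n t)).
      by move=> a b Ra _ Fab; apply: now; exists a => //; left; exists (a, b).
    by apply: jC; [have [] := top_min (R_S Rt)|exact: R_S].
  have RwE := R_eq Rw.
  exists w => //; exists n; first by rewrite /= ltnS; apply: absorb_max; rewrite RwE.
  exists t; first by rewrite /A RwE; split; [exact: ne|exact: R_S].
  by rewrite RwE -R_E; [rewrite /n prednK// R_lev|exact: R_S|exact: R_top Rt].
exists ((fun e => (par e, e)) @` bad); first exact: finite_image.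
(* [u] and [v] are inseparable from the apices of their nodes, so it suffices to pass from apex to
   apex along tree edges that are not bad. *)
move=> u v uv; apply: joined_trans (joinedm_sym (absorb_insep u fF)) _.
apply: joined_trans (absorb_insep v fF); move: uv.
apply: (joined_ind (P := fun c : node => joined (adj_minus F) (apex (absorb u)) (apex c))).
  exact: joined_refl.
move=> c e _ uc [ce [n1 n2]]; apply: joined_trans uc _.
case: ce => [[c0 ep]|[e0 cp]]; apply: contrapT => nj.
- apply: n2; exists c; rewrite -?ep//; split=> //.
  by rewrite -ep => /joinedm_sym.
- by apply: n1; exists e; rewrite -?cp//; split=> //; rewrite -cp.
Qed.
End RegionTree.

Lemma region_tree_exists (G : graph) : connected_graph G ->
  exists (T : graph) (f : vtx G -> vtx T), [/\ is_tree T, forall c, exists u, f u = c,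
    forall F' : set (vtx T * vtx T), finite_set F' ->
      exists2 F : set (vtx G * vtx G), finite_set F &
        forall u v, joined (adj_minus F) u v -> joined (adj_minus F') (f u) (f v) &
    forall F : set (vtx G * vtx G), finite_set F ->
      exists2 F' : set (vtx T * vtx T), finite_set F' &
        forall u v, joined (adj_minus F') (f u) (f v) -> joined (adj_minus F) u v].
Proof.
move=> Gc; have [[v0] _] := Gc; have [d d_desc] := connected_descent v0 Gc.
have top_ex (C : set (vtx G)) : exists t, forall u, C u -> C t /\ (d t <= d u)%N.
  have [[u Cu]|nC] := pselect (C !=set0); last by exists v0 => u Cu; case: nC; exists u.
  have ex : exists n, `[< exists2 u, C u & d u = n >] by exists (d u); apply/asboolP; exists u.
  case: (ex_minnP ex) => n /asboolP[t Ct tn] nmin; exists t => w Cw; split=> //.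
  by rewrite tn; apply: nmin; apply/asboolP; exists w.
have [top top_min] := choice top_ex.
have Q_ex (C : set (vtx G)) : exists Q : vtx G -> set (vtx G), finite_set (boundary C) ->
    (forall v, C v -> ~ insep (top C) v -> [/\ Q v v, is_region (Q v), Q v `<=` C &
        forall u, Q v u -> ~ insep (top C) u /\ Q u = Q v]) /\
    forall A, finite_set (boundary A) -> ~ A (top C) -> finite_set [set Q v | v in A `&` C].
  have [fC|nfC] := pselect (finite_set (boundary C)); last by exists (fun=> set0).
  by have [Q [Q1 Q2]] := region_children Gc (top C) fC; exists Q.
have [Q QP] := choice Q_ex.
have QP1 C v : finite_set (boundary C) -> C v -> ~ insep (top C) v ->
  [/\ Q C v v, is_region (Q C v), Q C v `<=` C &
      forall u, Q C v u -> ~ insep (top C) u /\ Q C u = Q C v].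
  by move=> fC; have [+ _] := QP C fC; apply.
have QP2 C A : finite_set (boundary C) -> finite_set (boundary A) ->
  ~ A (top C) -> finite_set [set Q C v | v in A `&` C].
  by move=> fC; have [_ +] := QP C fC; apply.
exists (region_tree top_min QP1), (absorb d_desc top_min QP1); split.
- exact: region_tree_is_tree.
- by move=> c; exists (apex c); exact: absorb_apex.
- exact: absorb_cont.
- exact: absorb_open.
Qed.

Theorem theorem1p2 (Y : topologicalType) :
  (exists G : graph, connected_graph G /\ homeomorphic Y (edge_end G)) <->
  (exists (T : graph) (X : set (vend T)),
      [/\ is_tree T, @ends_in T `<=` X & homeomorphic Y (set_type X)]).
Proof.
split => [[G [Gc YG]]|[T [X [hT XT YX]]]].
- have [T [f [hT f_surj f_cont f_open]]] := region_tree_exists Gc.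
  exists T, (limits f); split=> //; first exact: ends_in_limits.
  exact: homeomorphic_trans YG (limits_homeomorphic hT f_cont f_open).
- exists (blowup X); split; first exact: blowup_connected.
  exact: homeomorphic_trans YX (homeomorphic_sym (blowup_homeomorphic hT XT)).
Qed.
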